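(* Let $\mathcal{M}=(G,\{i\},\{j\},L)$ with $i\neq j$ be a linear compartmental model with $G$ strongly input-output connected, $2|V|-(k+2)$ edges where $k\geq 1$, and $|L|=|In\cup Out|$, where $In=\{i\}$, $Out=\{j\}$. If $\mathcal{M}$ is locally identifiable (or equivalently, $\widetilde{\mathcal{M}}=(G,\{i\},\{j\},V)$ is an identifiable path/cycle model), then it must have a path from $i$ to $j$ of length at most $k$.
   Context: A linear compartmental model $(G,In,Out,Leak)$ consists of a finite directed graph $G=(V,E)$ (no self-loops, no repeated edges) and subsets $In,Out,Leak\subseteq V$ (input, output and leak compartments; $In,Out$ nonempty). Each edge $j\to i$ carries an independent parameter $a_{ij}$ and each $i\in Leak$ an independent parameter $a_{0i}$. The compartmental matrix $A$ has $A_{ij}=a_{ij}$ if $j\to i\in E$; $A_{ii}=-a_{0i}-\sum_{l:\,i\to l\in E}a_{li}$ if $i\in Leak$; $A_{ii}=-\sum_{l:\,i\to l\in E}a_{li}$ if $i\notin Leak$; all other entries $0$. The model is the system $x'=Ax+u$, $y_i=x_i$ for $i\in Out$, with $u_i\equiv 0$ for $i\notin In$. When $Leak=V$, the diagonal entries $a_{ii}:=A_{ii}$ are algebraically independent and are used as parameters in place of the $a_{0i}$. When every vertex has a directed path to every output (which holds under the hypotheses here), the input-output equation for $j\in Out$ is $\det(\partial I-A)\,y_j=\sum_{i\in In}(-1)^{i+j}\det(\partial I-A)_{ij}\,u_i$, where $\partial=d/dt$ and $(\cdot)_{ij}$ means delete row $i$ and column $j$. The coefficient map $c$ from $\mathbb{R}^{|E|+|Leak|}$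 collects all nonzero, nonmonic coefficients (polynomials in the parameters) of these equations over all $j\in Out$. A cycle is a closed directed path with no repeated vertices; to a cycle or directed path associate the monomial that is the product of the parameters of its edges. The diagonal entries $a_{ii}$ count as monomial cycles of length 1 (self-cycles). The length of a path is its number of edges; paths are directed. $G$ is strongly input-output connected if it is connected (as an undirected graph) and every edge lies in a cycle or in a directed path from an input vertex to an output vertex. A function $f$ of the parameters is locally identifiable (from $c$) if there is a finitely multivalued function $\Phi$ with $\Phi\circ c=f$. A model $(G,In,Out,V)$ is an identifiable path/cycle model if all of the independent monomial cycles (including self-cycles) and monomial paths from input to output are locally identifiable and each parameter is contained in such a cycle or path. A model is (generically) locally identifiable if, outside a set of measure zero in parameter space, every point has a neighborhood on which $c$ is one-to-one; equivalently, the Jacobian of $c$ has rank $|E|+|Leak|$ at a generic point. *)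

(* Defs.v *)
From mathcomp Require Import all_boot all_order all_algebra.
From mathcomp Require Import all_classical all_reals all_analysis.

Set Implicit Arguments.
Unset Strict Implicit.
Unset Printing Implicit Defensive.

Import Order.TTheory GRing.Theory Num.Theory numFieldNormedType.Exports.
Local Open Scope ring_scope.

(* The vertex set of a graph is 'I_n and its edge set is
   E : {set 'I_n * 'I_n}; the pair (v, w) \in E is the edge v -> w, which
   carries the parameter a_{wv}. *)

Section Graphs.
Variable n : nat.
Implicit Types (E : {set 'I_n * 'I_n}) (In Out : {set 'I_n}).
Implicit Types (v w : 'I_n) (p c : seq 'I_n).

Definition edge_rel E : rel 'I_n := fun v w => (v, w) \in E.

Definition loopless E : Prop := forall v, (v, v) \notin E.

(* The sequence v :: p lists the vertices of the path, so its length (number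
   of edges) is size p. *)
Definition dipath E v p w : Prop :=
  [/\ path (edge_rel E) v p, uniq (v :: p) & last v p = w].

Definition path_edges v p : seq ('I_n * 'I_n) := zip (v :: p) p.

Definition dicycle E c : Prop :=
  [/\ c != [::], uniq c & cycle (edge_rel E) c].

Definition cycle_edges c : seq ('I_n * 'I_n) := zip c (rot 1 c).

Definition on_cycle_or_io_path E In Out (x : 'I_n * 'I_n) : Prop :=
  (exists c, dicycle E c /\ x \in cycle_edges c) \/
  (exists i j p, [/\ i \in In, j \in Out, dipath E i p j &
                     x \in path_edges i p]).

Definition weakly_connected E : Prop :=
  forall v w, connect (fun x y => edge_rel E x y || edge_rel E y x) v w.

Definition strongly_io_connected E In Out : Prop :=
  weakly_connected E /\
  (forall x, x \in E -> on_cycle_or_io_path E In Out x).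

End Graphs.

Section Matrices.
Variables (R : realType) (n : nat) (E : {set 'I_n * 'I_n}) (L : {set 'I_n}).

(* One parameter per edge and one per element of L; points of parameter space
   are row vectors of length #|param| = #|E| + #|L|. *)
Definition param : finType := ({x | x \in E} + {v | v \in L})%type.

Definition pspace := 'rV[R]_#|param|.

Definition edge_param (t : pspace) (x : 'I_n * 'I_n) : R :=
  if insub x : option {x | x \in E} is Some y
  then t ord0 (enum_rank (inl y : param)) else 0.

Definition vertex_param (t : pspace) (v : 'I_n) : R :=
  if insub v : option {v | v \in L} is Some y
  then t ord0 (enum_rank (inr y : param)) else 0.

Definition compartmental_mx (t : pspace) : 'M[R]_n :=
  \matrix_(i, j)
    if i == j
    then - vertex_param t i - \sum_(l | (i, l) \in E) edge_param t (i, l)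
    else edge_param t (j, i).

(* The vertex parameters are the diagonal entries a_ii themselves; this is the
   parametrization used when every compartment has a leak (L = V). *)
Definition diag_compartmental_mx (t : pspace) : 'M[R]_n :=
  \matrix_(i, j) if i == j then vertex_param t i else edge_param t (j, i).

Definition monomial (t : pspace) (s : seq ('I_n * 'I_n)) : R :=
  \prod_(x <- s) edge_param t x.

End Matrices.

Section CoefficientMap.
Variables (R : realType) (n : nat) (In Out : {set 'I_n}).

(* (j, None, d) stands for the coefficient of degree d on the left-hand side
   det(dI - A) y_j of the input-output equation of j, and (j, Some i, d) for
   the coefficient of degree d of the operator applied to u_i in that
   equation. *)
Definition coef_index : finType :=
  ({j | j \in Out} * option {i | i \in In} * 'I_n.+1)%type.

Definition io_coef (A : 'M[R]_n) (k : coef_index) : R :=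
  let: (j, o, d) := k in
  if o is Some i then (cofactor (char_poly_mx A) (val i) (val j))`_d
  else (char_poly A)`_d.

(* The entries of A depend linearly on the parameters, so each coefficient is
   a homogeneous polynomial in the parameters; the only constant ones are
   0 and the leading coefficients 1 of monic operators. *)
Definition proper_coef (T : Type) (A : T -> 'M[R]_n) (k : coef_index) : Prop :=
  (exists t, io_coef (A t) k <> 0) /\ ~ (forall t, io_coef (A t) k = 1).

Definition coef_map (T : Type) (A : T -> 'M[R]_n) (t : T) :
    {k | proper_coef A k} -> R :=
  fun k => io_coef (A t) (sval k).

End CoefficientMap.

Arguments coef_map {R n} In Out {T} A t _.

Section Identifiability.
Variables (R : realType) (m : nat).

Definition box (lo hi : 'rV[R]_m) : set 'rV[R]_m :=
  fun t => forall l, lo ord0 l <= t ord0 l <= hi ord0 l.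

Definition box_volume (lo hi : 'rV[R]_m) : R :=
  \prod_l (hi ord0 l - lo ord0 l).

(* Lebesgue measure zero in R^m, by countable covers with boxes.  The
   predicate D allows finite covers, which matters only when m = 0. *)
Definition measure_zero (N : set 'rV[R]_m) : Prop :=
  forall eps : R, 0 < eps ->
  exists (D : pred nat) (lo hi : nat -> 'rV[R]_m),
    [/\ forall k l, lo k ord0 l <= hi k ord0 l,
        forall t, N t -> exists2 k, D k & box (lo k) (hi k) t &
        (\sum_(0 <= k <oo | D k) (box_volume (lo k) (hi k))%:E <= eps%:E)%E].

Definition generically_locally_injective (T : Type) (c : 'rV[R]_m -> T) :
    Prop :=
  exists2 N : set 'rV[R]_m, measure_zero N &
    forall t, ~ N t -> exists2 U : set 'rV[R]_m, nbhs t U & set_inj U c.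

(* Phi is the finitely multivalued function.  As for models, identifiability
   is generic: a set of measure zero is disregarded. *)
Definition locally_identifiable_from (T : Type) (c : 'rV[R]_m -> T)
    (f : 'rV[R]_m -> R) : Prop :=
  exists Phi : T -> set R, (forall y, finite_set (Phi y)) /\
    exists2 N : set 'rV[R]_m, measure_zero N &
      forall t, ~ N t -> Phi (c t) (f t).

End Identifiability.

Section Models.
Variables (R : realType) (n : nat).
Implicit Types (E : {set 'I_n * 'I_n}) (In Out L : {set 'I_n}).

Definition locally_identifiable_model E In Out L : Prop :=
  generically_locally_injective
    (coef_map In Out (@compartmental_mx R n E L)).

(* The model (G, In, Out, V).  A diagonal parameter is always contained in its
   own self-cycle, so the last condition only concerns the edges. *)
Definition identifiable_path_cycle_model E In Out : Prop :=
  let c := coef_map In Out (@diag_compartmental_mx R n E [set: 'I_n]) in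
  [/\ forall v, locally_identifiable_from c (fun t => vertex_param t v),
      forall s, dicycle E s ->
        locally_identifiable_from c (fun t => monomial t (cycle_edges s)),
      forall i j p, i \in In -> j \in Out -> dipath E i p j ->
        locally_identifiable_from c (fun t => monomial t (path_edges i p)) &
      forall x, x \in E -> on_cycle_or_io_path E In Out x].

End Models.

(* Main.v *)
Require Import Defs.
From HB Require Import structures.
From mathcomp Require Import all_boot all_order all_algebra.
From mathcomp Require Import all_classical all_reals all_analysis.
From mathcomp Require Import measurable_realfun.
From mathcomp Require Import generic_quotient fraction polyrcf zify ring lra.
From mathcomp Require mpoly.
Import -(notations) mpoly.

(** Suppose that every path from i to j has length more than k.  Then the
    coefficient map cannot be identifiable, by a count of dimensions.

    Upper bound.  The coefficient of degree d of the cofactor (i, j) of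
    X - A is a combination of walks from i to j of length at most n - 1 - d
    ([cofactor_walk]), so it vanishes for d >= n - 1 - k.  Besides these
    coefficients, only the n nonleading ones of det(X - A) can vary.  Hence the
    coefficient map factors through N = 2n - 1 - k polynomials
    ([coef_map_polys]).

    Lower bound.  The model with leak set L has |E| + |L| = 2n - k > N
    parameters.  In the model with leak set V there are |E| + n parameters, and
    the differentials of the monomials of cycles, self-cycles and paths from i
    to j have rank at least |E| + 2 = 2n - k > N at the point where all
    parameters are 1 ([path_cycle_rank]).  Indeed an edge weighting with sum
    zero over all cycles and all paths from i to j is the coboundary of a
    potential vanishing at i and j ([potential]), and such potentials form a
    space of dimension n - 2.

    Contradiction.  Linear algebra over the field of rational functions gives a
    polynomial vector field v that annihilates the N coefficients but not some
    parameter, respectively some monomial f ([fiber_vector_field]).  Near a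
    suitable point, the coefficient map is constant along the flow of v while f
    is strictly monotone ([fiber_flow]), so the coefficient map fails to be
    locally injective on an open set, and f takes infinitely many values on
    fibers.

    The identifiability hypotheses disregard a null set, so the flow has to be
    started at a point that the flow maps, at infinitely many times, to points
    outside this null set ([box_avoid]).  At short times the flow shrinks no
    distance by more than a factor 2, hence preimages of null sets under it are
    null ([expanding_preimage_null]); and a box is not a countable union of null
    sets, by the countable subadditivity of volumes ([volume_cover_le]).

    The flow is built from Picard iterates.  These are polynomials in time, so
    that only derivatives of polynomials are ever used, and the properties of
    the flow are obtained as limits of those of the iterates. *)

Set Implicit Arguments.
Unset Strict Implicit.
Unset Printing Implicit Defensive.
Import Order.TTheory GRing.Theory Num.Theory numFieldNormedType.Exports.
Local Open Scope ring_scope.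

(** * Volumes of boxes and outer measure *)

Section Cover.
Local Open Scope classical_set_scope.
Local Open Scope ring_scope.
Variable R : realType.

Lemma lebesgue_measure_segment (a b : R) : a <= b ->
  lebesgue_measure (`[a, b] : set R) = (b - a)%:E.
Proof.
move=> ab; rewrite lebesgue_measure_itv /= lte_fin.
case: ltP => // ba; have -> : b = a by apply/le_anti; rewrite ba ab.
by rewrite subrr.
Qed.

(** Countable subadditivity of the volume of boxes in m dimensions.  Points are
    functions on nat of which only the first m coordinates matter, so that the
    slices of an (m+1)-dimensional box are m-dimensional boxes without any
    reindexing.  Induction on m: a slice of the box is covered by the slices of
    those members of the cover that it meets, and the resulting inequality is
    integrated over the last coordinate.  The predicate D selects the members
    in use; it is needed because a 0-dimensional box has volume 1. *)
Lemma volume_cover_le (m : nat) (D : nat -> bool) (a b : nat -> R)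
    (lo hi : nat -> nat -> R) :
  (forall l, a l <= b l) -> (forall k l, lo k l <= hi k l) ->
  (forall t : nat -> R, (forall l, (l < m)%N -> a l <= t l <= b l) ->
    exists2 k, D k & forall l, (l < m)%N -> lo k l <= t l <= hi k l) ->
  ((\prod_(l < m) (b l - a l))%:E <=
   \sum_(0 <= k <oo) ((D k)%:R * \prod_(l < m) (hi k l - lo k l))%:E)%E.
Proof.
move=> ab lohi; elim: m D => [|m IH] D cov.
  have [k Dk _] := cov a (fun l => fun h => ltac:(by [])).
  have h0 j : (0 <= ((D j)%:R * \prod_(l < 0) (hi j l - lo j l) : R)%:E)%E.
    by rewrite big_ord0 mulr1 lee_fin ler0n.
  apply: le_trans (nneseries_lim_ge k.+1 (fun j _ _ => h0 j)).
  rewrite big_nat_recr //= !big_ord0 Dk mulr1.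
  by apply: leeDr; apply: sume_ge0 => j _; have := h0 j; rewrite big_ord0.
pose V k := \prod_(l < m) (hi k l - lo k l).
have V0 k : 0 <= V k by apply: prodr_ge0 => l _; rewrite subr_ge0.
have W0 : 0 <= \prod_(l < m) (b l - a l).
  by apply: prodr_ge0 => l _; rewrite subr_ge0.
pose f k (x : R) := ((D k)%:R * V k * \1_(`[lo k m, hi k m]) x)%:E.
have f0 k x : (0 <= f k x)%E.
  by rewrite lee_fin !mulr_ge0 // ?ler0n // indicE ler0n.
have fm k : measurable_fun setT (f k).
  apply/measurable_EFinP; apply: measurable_funM => //.
have slice x : x \in `[a m, b m] ->
    ((\prod_(l < m) (b l - a l))%:E <= \sum_(0 <= k <oo) f k x)%E.
  move=> xab.
  have := IH (fun k => D k && (x \in `[lo k m, hi k m])).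
  move=> /(_ _)/le_trans; apply.
    move=> t ht.
    have ht' l : (l < m.+1)%N ->
        a l <= (if l == m then x else t l) <= b l.
      rewrite ltnS leq_eqVlt; case: eqP => [->|_] /= lm; last exact: ht.
      by move: xab; rewrite in_itv.
    have [k Dk hk] := cov _ ht'.
    exists k.
      rewrite Dk /= in_itv /=.
      by have := hk m (ltnSn m); rewrite eqxx.
    by move=> l lm; have := hk l (ltnW lm); rewrite (ltn_eqF lm).
  apply: lee_nneseries => [k _ _|k _].
    by rewrite lee_fin mulr_ge0 // ?ler0n //; exact: V0.
  rewrite lee_fin indicE -mulnb natrM mem_setE -!mulrA.
  by rewrite [X in _ * X <= _]mulrC.
rewrite big_ord_recr /= EFinM.
have -> : ((\prod_(l < m) (b l - a l))%:E * (b m - a m)%:E =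
  \int[lebesgue_measure]_(x in `[a m, b m]) (\prod_(l < m) (b l - a l))%:E)%E.
  rewrite (integral_cst lebesgue_measure (measurable_itv _)).
  by rewrite -(lebesgue_measure_segment (ab m)).
have fmD k : measurable_fun (`[a m, b m] : set R) (f k).
  exact: measurable_funS (fm k).
apply: (@le_trans _ _
    (\int[lebesgue_measure]_(x in `[a m, b m]) \sum_(0 <= k <oo) f k x)%E).
  apply: ge0_le_integral => //.
  have := @ge0_emeasurable_sum _ _ R `[a m, b m] f predT.
  by apply => [k x _ _|k _]; [exact: f0|exact: fmD].
rewrite integral_nneseries //.
apply: lee_nneseries => [k _ _|k _].
  by apply: integral_ge0 => x _; exact: f0.
rewrite /f; under eq_integral do rewrite EFinM.
rewrite ge0_integralZl //; last 2 first.
- apply/measurable_EFinP.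
  exact: measurable_indic.
- by rewrite lee_fin mulr_ge0 // ?ler0n //; exact: V0.
rewrite integral_indic // big_ord_recr /= mulrA.
rewrite [in leRHS]EFinM; apply: lee_wpmul2l.
  by rewrite lee_fin mulr_ge0 // ?ler0n //; exact: V0.
rewrite -lebesgue_measure_segment //.
apply: le_measure; rewrite ?inE //; exact: measurableI.
Qed.
End Cover.

Section OuterMeasure.
Local Open Scope classical_set_scope.
Local Open Scope ring_scope.
Variables (R : realType) (m : nat).
Implicit Types (S : set 'rV[R]_m) (lo hi : 'rV[R]_m).

(** The least volume of a box containing S, infinite when S is unbounded.  The
    empty set costs 0 by convention, which matters only when m = 0. *)
Definition box_cost S : \bar R :=
  if S == set0 then 0%E else
  ereal_inf [set x | exists lo hi, [/\ forall l, lo ord0 l <= hi ord0 l,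
    S `<=` box lo hi & x = (box_volume lo hi)%:E]].

Lemma box_volume_ge0 lo hi : (forall l, lo ord0 l <= hi ord0 l) ->
  0 <= box_volume lo hi.
Proof. by move=> h; apply: prodr_ge0 => l _; rewrite subr_ge0. Qed.

Lemma box_cost_ge0 S : (0 <= box_cost S)%E.
Proof.
rewrite /box_cost; case: ifP => // _.
apply: le_ereal_inf_tmp => _ [lo [hi [h _ ->]]].
by rewrite lee_fin box_volume_ge0.
Qed.

Lemma box_cost0 : box_cost set0 = 0%E.
Proof. by rewrite /box_cost eqxx. Qed.

(** Lebesgue outer measure on R^m: the infimum of the total cost of countable
    covers by arbitrary sets.  The generated sigma-algebra of all subsets makes
    every set an admissible member of a cover. *)
Definition outer : set 'rV[R]_m -> \bar R :=
  @mu_ext _ (g_sigma_algebraType [set: set 'rV[R]_m]) R box_cost.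

HB.instance Definition _ := isOuterMeasure.Build R 'rV[R]_m outer
  (mu_ext0 (T := g_sigma_algebraType [set: set 'rV[R]_m])
     box_cost0 box_cost_ge0)
  (mu_ext_ge0 (T := g_sigma_algebraType [set: set 'rV[R]_m]) box_cost_ge0)
  (@le_mu_ext _ (g_sigma_algebraType [set: set 'rV[R]_m]) R box_cost)
  (mu_ext_sigma_subadditive (T := g_sigma_algebraType [set: set 'rV[R]_m])
     box_cost_ge0).

Lemma outer_le_cover S (F : nat -> set 'rV[R]_m) :
  S `<=` \bigcup_k F k -> (outer S <= \sum_(0 <= k <oo) box_cost (F k))%E.
Proof.
move=> SF; apply: ereal_inf_lbound; exists F => //; split => // k.
exact: sub_gen_smallest.
Qed.

Lemma outer_box_le S lo hi : (forall l, lo ord0 l <= hi ord0 l) ->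
  S `<=` box lo hi -> (outer S <= (box_volume lo hi)%:E)%E.
Proof.
move=> h Sb.
pose F k := if k == 0%N then S else set0 : set 'rV[R]_m.
have SF : S `<=` \bigcup_k F k by move=> t St; exists 0%N.
apply: (le_trans (outer_le_cover SF)).
rewrite (nneseries_split 0 1) ?add0n; last by move=> k _; exact: box_cost_ge0.
rewrite big_nat1 /= eseries0 ?adde0; last first.
  by move=> [|k] // _ _; rewrite /F /= box_cost0.
rewrite /F /= /box_cost; case: ifP => _; first by rewrite lee_fin box_volume_ge0.
by apply: ereal_inf_lbound; exists lo, hi.
Qed.

(** The box realizing the cost up to e; the boolean D is false when S is empty,
    in which case no box is needed. *)
Lemma box_cost_adherent S (e : R) : 0 < e -> (box_cost S < +oo)%E ->
  exists (D : bool) lo hi, [/\ forall l, lo ord0 l <= hi ord0 l,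
    forall t, S t -> D /\ box lo hi t &
    ((D%:R * box_volume lo hi)%:E <= box_cost S + e%:E)%E].
Proof.
move=> e0; have := box_cost_ge0 S; rewrite /box_cost; case: eqP => [->|_].
  move=> _ _; exists false, 0, 0; split => //.
  by rewrite mul0r add0e lee_fin ltW.
set I := ereal_inf _ => I0 Ioo.
have If : I \is a fin_num by rewrite ge0_fin_numE.
have [x [lo [hi [h Sb ->]]] /ltW hx] := lb_ereal_inf_adherent e0 If.
exists true, lo, hi; split => //; last by rewrite mul1r.
by move=> t /Sb.
Qed.

Lemma outer_box_ge lo hi : (forall l, lo ord0 l <= hi ord0 l) ->
  ((box_volume lo hi)%:E <= outer (box lo hi))%E.
Proof.
move=> lohi; apply: le_ereal_inf_tmp => _ [F [_ cF] <-].
have [[i ioo]|] := pselect (exists i, box_cost (F i) = +oo%E).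
  rewrite (eseries_pinfty _ _ ioo) ?leey // => k _.
  by rewrite -ltNye (lt_le_trans _ (box_cost_ge0 _)).
rewrite -forallNE => Foo.
apply/lee_addgt0Pr => e e0.
apply: (le_trans _ (epsilon_trick _ _ (ltW e0))); last first.
  by move=> k; exact: box_cost_ge0.
have /choice [G HG] k : exists x : bool * 'rV[R]_m * 'rV[R]_m,
    [/\ forall l, x.1.2 ord0 l <= x.2 ord0 l,
    forall t, F k t -> x.1.1 /\ box x.1.2 x.2 t &
    ((x.1.1%:R * box_volume x.1.2 x.2)%:E <=
       box_cost (F k) + (e / (2 ^ k.+1)%:R)%:E)%E].
  have [||D [l [h H]]] := @box_cost_adherent (F k) (e / (2 ^ k.+1)%:R).
  - by rewrite divr_gt0 // ltr0n expn_gt0.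
  - by rewrite ltey; apply/eqP.
  - by exists (D, l, h).
pose ext (v : 'rV[R]_m) (l : nat) : R :=
  if insub l is Some l' then v ord0 l' else 0.
have extE (v : 'rV[R]_m) (l : 'I_m) : ext v l = v ord0 l by rewrite /ext valK.
have extP (P : R -> R -> Prop) (v w : 'rV[R]_m) : P 0 0 ->
    (forall l, P (v ord0 l) (w ord0 l)) -> forall l, P (ext v l) (ext w l).
  by move=> P0 H l; rewrite /ext; case: insubP.
have := @volume_cover_le R m (fun k => (G k).1.1) (ext lo) (ext hi)
  (fun k => ext (G k).1.2) (fun k => ext (G k).2).
move=> /(_ (extP (fun x y => x <= y) _ _ (lexx _) lohi)).
move=> /(_ (fun k => extP (fun x y => x <= y) _ _ (lexx _)
  (let: And3 h _ _ := HG k in h))).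
have eqv (v w : 'rV[R]_m) : \prod_(l < m) (ext v l - ext w l) = box_volume w v.
  by apply: eq_bigr => l _; rewrite !extE.
rewrite eqv => /(_ _) /le_trans; apply; last first.
  apply: lee_nneseries => [k _ _|k _]; rewrite eqv.
    by rewrite lee_fin mulr_ge0 ?ler0n ?box_volume_ge0 //; case: (HG k).
  by case: (HG k).
move=> t tb; pose t' : 'rV[R]_m := \row_l t l.
have /cF [k _ Fk] : box lo hi t'.
  by move=> l; rewrite mxE; have := tb l (ltn_ord l); rewrite !extE.
have [_ /(_ _ Fk) [Dk bk] _] := HG k.
exists k => // l lm.
by have := bk (Ordinal lm); rewrite mxE -!extE.
Qed.

Lemma outer_seq (T : eqType) (s : seq T) (F : T -> set 'rV[R]_m) S (c : R) :
  0 <= c -> (forall q, q \in s -> (outer (F q) <= c%:E)%E) ->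
  (forall t, S t -> exists2 q, q \in s & F q t) ->
  (outer S <= ((size s)%:R * c)%:E)%E.
Proof.
move=> c0; elim: s S => [|q s IH] S Fc SF.
  rewrite mul0r (_ : S = set0) ?outer_measure0 //.
  by apply/seteqP; split => // t /SF [].
pose S' := S `&` [set t | exists2 q, q \in s & F q t].
apply: (@le_trans _ _ (outer (F q `|` S'))).
  apply: le_outer_measure => t St; have [q'] := SF t St.
  by rewrite inE => /orP[/eqP -> Ft|q's Ft]; [left|right; split => //; exists q'].
apply: (le_trans (outer_measureU2 _ _ _)).
rewrite /= -addn1 natrD mulrDl mul1r addrC EFinD.
have hq : (outer (F q) <= c%:E)%E by apply: Fc; rewrite inE eqxx.
have hS : (outer S' <= ((size s)%:R * c)%:E)%E.
  apply: IH => [q' q's|t []] //.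
  by apply: Fc; rewrite inE q's orbT.
exact: leeD hS hq.
Qed.

Lemma prod_shift_le (a : 'I_m -> R) : (forall l, 0 <= a l) ->
  exists2 C : R, 0 <= C & forall d, 0 <= d <= 1 ->
    \prod_l (a l + d) <= \prod_l a l + C * d.
Proof.
move=> a0; elim: (index_enum 'I_m) => [|l s [C C0 IH]].
  by exists 0 => // d _; rewrite !big_nil mul0r addr0.
have P0 : 0 <= \prod_(l <- s) a l by apply: prodr_ge0.
exists (a l * C + \prod_(l <- s) a l + C).
  by rewrite !addr_ge0 ?mulr_ge0.
move=> d /andP[d0 d1]; rewrite !big_cons.
have /(ler_wpM2l (addr_ge0 (a0 l) d0)) : \prod_(l <- s) (a l + d) <=
    \prod_(l <- s) a l + C * d by apply: IH; rewrite d0.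
move=> /le_trans; apply.
have dd : d * d <= d by rewrite ler_piMr.
have := ler_wpM2l C0 dd.
by nra.
Qed.

(** phi shrinks no sup-norm distance on B by more than a factor 2; the images
    under the inverse of such a map are controlled by a Lipschitz bound. *)
Definition expanding_on (B : set 'rV[R]_m) (phi : 'rV[R]_m -> 'rV[R]_m) : Prop :=
  forall t t', B t -> B t' -> forall d : R,
    (forall l, `|phi t ord0 l - phi t' ord0 l| <= d) ->
    forall l, `|t ord0 l - t' ord0 l| <= 2 * d.

Lemma expanding_preimage_cube B phi lo hi (d : R) :
  expanding_on B phi -> 0 < d ->
  (forall l, hi ord0 l = lo ord0 l + d) ->
  (outer (B `&` phi @^-1` box lo hi) <= ((4 * d) ^+ m)%:E)%E.
Proof.
move=> Bphi d0 hilo; set S := _ `&` _.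
have [[t0 [Bt0 bt0]]|] := pselect (exists t, S t); last first.
  move=> S0; rewrite (_ : S = set0) ?outer_measure0; last first.
    by apply/seteqP; split => // t St; apply: S0; exists t.
  by rewrite lee_fin exprn_ge0 // mulr_ge0 // ltW.
pose lo' : 'rV[R]_m := \row_l (t0 ord0 l - 2 * d).
pose hi' : 'rV[R]_m := \row_l (t0 ord0 l + 2 * d).
have -> : (4 * d) ^+ m = box_volume lo' hi'.
  rewrite /box_volume (eq_bigr (fun=> 4 * d)) ?prodr_const ?card_ord //.
  by move=> l _; rewrite !mxE; ring.
apply: outer_box_le => [l|t [Bt bt] l]; rewrite !mxE; first by lra.
suff : `|t ord0 l - t0 ord0 l| <= 2 * d by rewrite ler_norml; lra.
apply: Bphi => // l'; rewrite ler_norml.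
have := bt l'; have := bt0 l'; rewrite hilo; lra.
Qed.

(** The preimage under an expanding map of a box of volume V has outer measure
    at most 4^m V: subdivide the box into cubes of small side d, each of which
    has a preimage of diameter at most 2d. *)
Lemma expanding_preimage_box B phi lo hi :
  expanding_on B phi -> (forall l, lo ord0 l <= hi ord0 l) ->
  (outer (B `&` phi @^-1` box lo hi) <= (4 ^+ m * box_volume lo hi)%:E)%E.
Proof.
move=> Bphi lohi.
pose a l := hi ord0 l - lo ord0 l.
have a0 l : 0 <= a l by rewrite subr_ge0.
have grid (d : R) : 0 < d ->
    (outer (B `&` phi @^-1` box lo hi) <= (4 ^+ m * \prod_l (a l + d))%:E)%E.
  move=> d0.
  (* k l cubes of side d are enough to cover the side of length a l. *)
  pose k l := (Num.truncn (a l / d)).+1.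
  pose cube (q : {dffun forall l, 'I_(k l)}) : set 'rV[R]_m :=
    box (\row_l (lo ord0 l + (q l)%:R * d)) (\row_l (lo ord0 l + (q l)%:R * d + d)).
  have := @outer_seq _ (enum {: {dffun forall l, 'I_(k l)}})
    (fun q => B `&` phi @^-1` cube q) (B `&` phi @^-1` box lo hi) ((4 * d) ^+ m).
  move=> /(_ _ _ _)/le_trans; apply.
  - by rewrite exprn_ge0 // mulr_ge0 // ltW.
  - move=> q _; apply: expanding_preimage_cube => // l.
    by rewrite !mxE.
  - move=> t [Bt bt].
    pose x l := (phi t ord0 l - lo ord0 l) / d.
    have x0 l : 0 <= x l.
      by rewrite divr_ge0 ?(ltW d0) // subr_ge0; have /andP[] := bt l.
    have xk l : (Num.truncn (x l) < k l)%N.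
      rewrite ltnS; apply: le_truncn; rewrite ler_pM2r ?invr_gt0 //.
      by rewrite lerB //; have /andP[] := bt l.
    pose q : {dffun forall l, 'I_(k l)} := [ffun l => Ordinal (xk l)].
    exists q; first by rewrite mem_enum.
    split => // l; rewrite !mxE ffunE /=.
    have := truncn_itv (x0 l); rewrite -addn1 natrD.
    rewrite /x ler_pdivlMr // ltr_pdivrMr // => /andP[h1 h2].
    by apply/andP; split; lra.
  rewrite lee_fin -cardT card_dep_ffun foldrE big_map big_enum /=.
  have pc (x : R) : x ^+ m = \prod_(l < m) x by rewrite prodr_const card_ord.
  rewrite natr_prod !pc -!big_split /=.
  apply: ler_prod => l _; rewrite card_ord.
  have := truncn_itv (divr_ge0 (a0 l) (ltW d0)) => /andP[+ _].
  rewrite ler_pdivlMr // => h.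
  rewrite /k -addn1 natrD; move: h; set u := (Num.truncn _)%:R => h.
  have u0 : 0 <= u by exact: ler0n.
  by apply/andP; split; nra.
have [C C0 HC] := prod_shift_le a0.
apply/lee_addgt0Pr => e e0.
pose d : R := Num.min 1 (e / (4 ^+ m * C + 1)).
have K0 : 0 <= 4 ^+ m * C by rewrite mulr_ge0 // exprn_ge0.
have K1 : 0 < 4 ^+ m * C + 1 by lra.
have d0 : 0 < d by rewrite lt_min ltr01 divr_gt0.
have d1 : d <= 1 by rewrite ge_min lexx.
have dC : d * (4 ^+ m * C + 1) <= e by rewrite -ler_pdivlMr // ge_min lexx orbT.
apply: (le_trans (grid d d0)).
have := HC d; rewrite (ltW d0) d1 => /(_ isT).
move=> /(ler_wpM2l (exprn_ge0 m (ler0n R 4))) h.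
rewrite -EFinD lee_fin; apply: (le_trans h).
rewrite mulrDr /box_volume mulrA.
by rewrite lerD2l; lra.
Qed.

Lemma expanding_preimage_null B phi (N : set 'rV[R]_m) :
  expanding_on B phi -> measure_zero N ->
  outer (B `&` phi @^-1` N) = 0%E.
Proof.
move=> Bphi N0; apply/eqP; rewrite eq_le outer_measure_ge0 andbT.
apply/lee_addgt0Pr => e e0; rewrite add0e.
have e40 : 0 < e / 4 ^+ m by rewrite divr_gt0 // exprn_gt0.
have [D [lo [hi [lohi Ncov Nsum]]]] := N0 _ e40.
pose F k := if D k then B `&` phi @^-1` box (lo k) (hi k) else set0.
apply: (@le_trans _ _ (outer (\bigcup_k F k))).
  apply: le_outer_measure => t [Bt /Ncov [k Dk bk]].
  by exists k => //; rewrite /F Dk.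
apply: (le_trans (outer_measure_sigma_subadditive _ F)).
apply: (@le_trans _ _
  (\sum_(0 <= k <oo) ((4 ^+ m)%:E *
    (if D k then box_volume (lo k) (hi k) else 0)%:E))%E).
  apply: lee_nneseries => [k _ _|k _]; first exact: outer_measure_ge0.
  rewrite /F; case: ifP => Dk; last by rewrite mule0 outer_measure0.
  exact: expanding_preimage_box.
rewrite nneseriesZl; last first.
  by move=> k _; rewrite lee_fin; case: ifP => // _; exact: box_volume_ge0.
rewrite -(@lee_pdivlMl _ (4 ^+ m)) ?exprn_gt0 // -EFinM mulrC.
apply: le_trans Nsum.
rewrite [in leRHS]eseries_mkcond; apply: lee_nneseries => [k _ _|k _].
  by rewrite lee_fin; case: ifP => // _; exact: box_volume_ge0.
by case: ifP.
Qed.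

(** Countably many expanding maps can be made to avoid a null set
    simultaneously, by a suitable choice of the starting point. *)
Lemma box_avoid (N : set 'rV[R]_m) (phi : nat -> 'rV[R]_m -> 'rV[R]_m) lo hi :
  (forall l, lo ord0 l < hi ord0 l) -> measure_zero N ->
  (forall k, expanding_on (box lo hi) (phi k)) ->
  exists2 t, box lo hi t & forall k, ~ N (phi k t).
Proof.
move=> lohi N0 ephi; apply: contrapT => H.
have : (outer (box lo hi) <= 0)%E.
  apply: (@le_trans _ _ (outer (\bigcup_k (box lo hi `&` phi k @^-1` N)))).
    apply: le_outer_measure => t bt.
    have [k Nk] : exists k, N (phi k t).
      apply: contrapT => Hk; apply: H; exists t => // k Nk.
      by apply: Hk; exists k.
    by exists k.
  apply: (le_trans (outer_measure_sigma_subadditive _ _)).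
  by rewrite eseries0 // => k _ _; exact: expanding_preimage_null.
have := outer_box_ge (fun l => ltW (lohi l)) => /le_trans /[apply].
rewrite lee_fin leNgt prodr_gt0 // => l _.
by rewrite subr_gt0.
Qed.

End OuterMeasure.

(** * Polynomials in several variables *)

(** The polynomial X_l. *)
Definition mpvar (R : nzRingType) (m : nat) (l : 'I_m) : mpoly m R :=
  mpolyX R (mnm1 l).

Lemma mpoly_ring_ind (R : comNzRingType) (m : nat) (P : mpoly m R -> Prop) :
  (forall c, P (mpolyC m c)) -> (forall l, P (mpvar R l)) ->
  (forall p q, P p -> P q -> P (p + q)) ->
  (forall p q, P p -> P q -> P (p * q)) -> forall p, P p.
Proof.
move=> PC PX PD PM; have P0 : P 0 by rewrite -mpolyC0; exact: PC.
have P1 : P 1 by exact: (PC 1).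
elim/mpolyind => // c mu p _ _ Pp; apply: (PD) => //.
rewrite -mul_mpolyC; apply: (PM) => //; rewrite mpolyXE_id.
apply: (big_ind P P1 PM) => l _.
by elim: (mu l) => [|e IH];
  [rewrite expr0|rewrite exprS; apply: (PM) => //; exact: (PX l)].
Qed.

Section Curves.
Variables (R : comNzRingType) (m : nat) (g : 'I_m -> {poly R}).

(** The restriction of a polynomial p in m variables to the polynomial curve
    g : a polynomial in the parameter of the curve. *)
Definition along (p : mpoly m R) : {poly R} := mmap (@polyC R) g p.

Lemma alongC c : along (mpolyC m c) = c%:P.
Proof. exact: mmapC. Qed.

Lemma along_var l : along (mpvar R l) = g l.
Proof. by rewrite /along /mpvar mmapX mmap1U. Qed.

Lemma alongD p q : along (p + q) = along p + along q.
Proof. exact: mmapD. Qed.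

Lemma alongM p q : along (p * q) = along p * along q.
Proof. by rewrite /along rmorphM. Qed.

Lemma horner_along p s : (along p).[s] = meval (fun l => (g l).[s]) p.
Proof.
elim/mpoly_ring_ind: p => [c|l|p q Hp Hq|p q Hp Hq].
- by rewrite alongC hornerC mevalC.
- by rewrite along_var /mpvar mevalXU.
- by rewrite alongD hornerD mevalD Hp Hq.
- by rewrite alongM hornerM mevalM Hp Hq.
Qed.

Lemma deriv_along p :
  (along p)^`() = \sum_l along (mderiv l p) * (g l)^`().
Proof.
elim/mpoly_ring_ind: p => [c|l|p q Hp Hq|p q Hp Hq].
- rewrite alongC derivC big1 // => l _; rewrite mderivC.
  by rewrite -mpolyC0 alongC mul0r.
- rewrite along_var (bigD1 l) //= big1 ?addr0 => [|k kl].
    by rewrite mderivX mnm1E eqxx scale1r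
      -[X in mnm_sub X]add0m addmK mpolyX0 alongC mul1r.
  by rewrite mderivX mnm1E eq_sym (negbTE kl) scale0r -mpolyC0 alongC mul0r.
- rewrite alongD derivD Hp Hq -big_split; apply: eq_bigr => l _ /=.
  by rewrite mderivD alongD mulrDl.
- rewrite alongM derivM Hp Hq mulr_suml mulr_sumr -big_split.
  apply: eq_bigr => l _ /=.
  by rewrite mderivM alongD !alongM; ring.
Qed.
End Curves.

Section Vanishing.
Variables (R : realFieldType) (m : nat).

Lemma meval_zero (p : mpoly m R) : meval (fun=> 0) p = mcoeff mnm0 p.
Proof.
elim/mpoly_ring_ind: p => [c|l|p q Hp Hq|p q Hp Hq].
- by rewrite mevalC mcoeffC eqxx mulr1.
- rewrite /mpvar mevalXU mcoeffX.
  by have /negbTE -> : mnm1 l != mnm0 by rewrite -mdeg_eq0 mdeg1.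
- by rewrite mevalD mcoeffD Hp Hq.
- by rewrite mevalM Hp Hq rmorphM.
Qed.

Lemma vanishing_mderiv (p : mpoly m R) l :
  (forall t, meval t p = 0) -> forall t, meval t (mderiv l p) = 0.
Proof.
move=> p0 t; pose g k : {poly R} := (t k)%:P + (k == l)%:R *: 'X.
have g0 : along g p = 0.
  apply/eqP; apply: contraT => nz.
  (* The restriction has more roots than its degree permits. *)
  pose rs := [seq i%:R : R | i <- iota 0 (size (along g p))].
  have := max_poly_roots nz (rs := rs).
  rewrite size_map size_iota ltnn; apply.
    by apply/allP => x _; rewrite rootE horner_along p0.
  rewrite map_inj_uniq ?iota_uniq // => x y.
  by move/eqP; rewrite eqr_nat => /eqP.
have := congr1 (fun q => q^`().[0]) g0; rewrite /= deriv0 horner0 deriv_along.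
rewrite horner_sum (bigD1 l) //= big1 ?addr0 => [|k kl].
  rewrite hornerM horner_along /g derivD derivC derivZ derivX add0r eqxx.
  rewrite alg_polyC hornerC mulr1 => H; rewrite -[RHS]H; apply: meval_eq => k.
  by rewrite hornerD hornerC hornerZ hornerX mulr0 addr0.
by rewrite /g derivD derivC derivZ derivX add0r (negbTE kl) scale0r mulr0 horner0.
Qed.

(** A polynomial function determines its polynomial.  The partial derivatives
    of a vanishing polynomial vanish too, so every coefficient is reached, up to
    a nonzero factor, by differentiating and evaluating at 0. *)
Lemma vanishing_eq0 (p : mpoly m R) : (forall t, meval t p = 0) -> p = 0.
Proof.
move=> p0; apply/mpolyP => mu; rewrite mcoeff0.
move: {2}(mdeg mu) (erefl (mdeg mu)) => d.
elim: d mu p p0 => [|d IH] mu p p0 Hd.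
  move/eqP: Hd; rewrite mdeg_eq0 => /eqP ->.
  by rewrite -meval_zero p0.
have [l ml] : exists l, mu l != 0%N.
  apply/existsP; apply: contraT; rewrite negb_exists => /forallP h.
  have : mu = mnm0.
    by apply/mnmP => l; rewrite mnm0E; apply/eqP; have := h l; rewrite negbK.
  by move=> E; move: Hd; rewrite E mdeg0.
have Emu := submK (m' := mu) (m := mnm1 l); rewrite lep1mP ml in Emu.
have {}Emu := Emu isT.
have Hd' : mdeg (mnm_sub mu (mnm1 l)) = d.
  by move: Hd; rewrite -{1}Emu mdegD mdeg1 addn1 => -[].
have := IH _ _ (vanishing_mderiv l p0) Hd'.
rewrite mcoeff_deriv Emu => /eqP.
by rewrite mulrn_eq0 /= => /eqP.
Qed.

Lemma mpoly_neq0_eval (p : mpoly m R) : p != 0 -> exists t, meval t p != 0.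
Proof.
move=> p0; apply: contrapT => H; move/eqP: p0; apply.
apply: vanishing_eq0 => t; apply/eqP; apply: contraT => h.
by case: H; exists t.
Qed.
End Vanishing.

Section Bounds.
Variables (R : realFieldType) (m : nat).

Lemma meval_bounded_lipschitz (p : mpoly m R) (r : R) : exists K : R,
  [/\ 0 <= K,
   forall t, (forall l, `|t l| <= r) -> `|meval t p| <= K &
   forall t t' d, (forall l, `|t l| <= r) -> (forall l, `|t' l| <= r) ->
     (forall l, `|t l - t' l| <= d) -> 0 <= d ->
     `|meval t p - meval t' p| <= K * d].
Proof.
elim/mpoly_ring_ind: p =>
  [c|l|p q [K [K0 Kb Kl]] [L [L0 Lb Ll]]|p q [K [K0 Kb Kl]] [L [L0 Lb Ll]]].
- exists `|c|; split => // [t _|t t' d _ _ _ d0]; rewrite !mevalC //.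
  by rewrite subrr normr0 mulr_ge0.
- exists (`|r| + 1); split; first by rewrite addr_ge0.
    move=> t h; rewrite /mpvar mevalXU (le_trans (h l)) //.
    by rewrite (le_trans (ler_norm _)) // lerDl.
  move=> t t' d h h' hd d0; rewrite /mpvar !mevalXU (le_trans (hd l)) //.
  by rewrite mulrDl mul1r lerDr mulr_ge0.
- exists (K + L); split; first by rewrite addr_ge0.
    by move=> t h; rewrite mevalD (le_trans (ler_normD _ _)) // lerD ?Kb ?Lb.
  move=> t t' d h h' hd d0; rewrite !mevalD mulrDl.
  rewrite (_ : _ - _ = (meval t p - meval t' p) + (meval t q - meval t' q)).
    by rewrite (le_trans (ler_normD _ _)) // lerD ?Kl ?Ll.
  by ring.
- have KL : 0 <= K * L by rewrite mulr_ge0.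
  exists (2 * (K * L)); split; first by lra.
    move=> t h; rewrite mevalM normrM.
    have : `|meval t p| * `|meval t q| <= K * L by rewrite ler_pM ?Kb ?Lb.
    by lra.
  move=> t t' d h h' hd d0; rewrite !mevalM.
  rewrite (_ : _ - _ = (meval t p - meval t' p) * meval t q +
    meval t' p * (meval t q - meval t' q)); last by ring.
  rewrite (le_trans (ler_normD _ _)) // !normrM.
  have h1 : `|meval t p - meval t' p| * `|meval t q| <= K * d * L.
    by rewrite ler_pM ?Kl ?Lb.
  have h2 : `|meval t' p| * `|meval t q - meval t' q| <= K * (L * d).
    by rewrite ler_pM ?Kb ?Ll.
  by lra.
Qed.

End Bounds.

(** * The flow of a polynomial vector field *)

Section PolyMVT.
Variable R : rcfType.
Implicit Types (p : {poly R}) (e K s : R).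

Definition antideriv p : {poly R} := \poly_(i < (size p).+1) (p`_i.-1 / i%:R).

Lemma deriv_antideriv p : (antideriv p)^`() = p.
Proof.
apply/polyP => i; rewrite coef_deriv coef_poly ltnS /=.
case: ltnP => [_|h]; first by rewrite -(mulr_natr (_ / _)) mulfVK // pnatr_eq0.
by rewrite mul0rn nth_default.
Qed.

Lemma antideriv0 p : (antideriv p).[0] = 0.
Proof. by rewrite horner_coef0 coef_poly /= invr0 mulr0. Qed.

Lemma poly_growth p e k s s' :
  (forall x, `|x| <= e -> k <= p^`().[x]) ->
  - e <= s -> s <= s' -> s' <= e -> k * (s' - s) <= p.[s'] - p.[s].
Proof.
move=> hk es ss' s'e; move: ss'; rewrite le_eqVlt => /orP[/eqP <-|ss'].
  by rewrite !subrr mulr0.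
have [c cs ->] := poly_mvt p ss'.
rewrite ler_pM2r ?subr_gt0 //; apply: hk.
by move: cs; rewrite in_itv /= ler_norml => /andP[? ?]; apply/andP; split; lra.
Qed.

Lemma poly_lipschitz0 p e K s : (forall x, `|x| <= e -> `|p^`().[x]| <= K) ->
  `|s| <= e -> `|p.[s] - p.[0]| <= K * `|s|.
Proof.
move=> hK; rewrite ler_norml => /andP[es se].
have h1 x : `|x| <= e -> - K <= p^`().[x].
  by move=> /hK; rewrite ler_norml => /andP[].
have h2 x : `|x| <= e -> - K <= (- p)^`().[x].
  by move=> /hK; rewrite ler_norml derivN hornerN lerN2 => /andP[].
have e0 : 0 <= e by lra.
have [s0|s0] := lerP 0 s.
  have := poly_growth h1 (_ : - e <= 0) s0 se.
  have := poly_growth h2 (_ : - e <= 0) s0 se.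
  rewrite !hornerN oppr_le0 => /(_ e0) a1 /(_ e0) a2.
  by rewrite ler_norml ger0_norm //; apply/andP; split; lra.
have := poly_growth h1 es (ltW s0) e0.
have := poly_growth h2 es (ltW s0) e0.
rewrite !hornerN => a1 a2.
by rewrite ler_norml ltr0_norm //; apply/andP; split; lra.
Qed.
End PolyMVT.

Section Limits.
Local Open Scope classical_set_scope.
Local Open Scope ring_scope.
Variable R : realType.

Lemma cvgn_geometric (u : nat -> R) (r z : R) : 0 <= r -> 0 <= z < 1 ->
  (forall q, `|u q.+1 - u q| <= r * z ^+ q) -> cvgn u.
Proof.
move=> r0 /andP[z0 z1] hu.
have : cvgn (series (telescope u)).
  apply: normed_cvg.
  apply: (@series_le_cvg _ _ (geometric r z)) => //=.
  - by move=> n; rewrite mulr_ge0 // exprn_ge0.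
  - by apply: is_cvg_geometric_series; rewrite ger0_norm.
move=> h.
have -> : u = (fun n => u 0%N + series (telescope u) n).
  by apply/funext => n; rewrite telescopeK /= addrC subrK.
by apply: is_cvgD => //; exact: is_cvg_cst.
Qed.

Lemma cvgn_norm_le (u : nat -> R) (a C : R) : u @ \oo --> a ->
  (forall q, `|u q| <= C) -> `|a| <= C.
Proof.
move=> ua hu; have /cvg_norm := ua => h.
rewrite -(cvg_lim _ h) //; apply: limr_le; first by apply/cvg_ex; exists `|a|.
by apply: nearW.
Qed.

Lemma cvgn_meval (m : nat) (u : nat -> 'I_m -> R) (a : 'I_m -> R) :
  (forall l, u ^~ l @ \oo --> a l) ->
  forall p : mpoly m R, (fun q => meval (u q) p) @ \oo --> meval a p.
Proof.
move=> ua; elim/mpoly_ring_ind => [c|l|p q Hp Hq|p q Hp Hq].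
- rewrite mevalC (_ : (fun _ => _) = fun=> c); first exact: cvg_cst.
  by apply/funext => k; rewrite mevalC.
- rewrite /mpvar mevalXU (_ : (fun _ => _) = u ^~ l) //.
  by apply/funext => k; rewrite mevalXU.
- rewrite mevalD (_ : (fun _ => _) =
    (fun k => meval (u k) p) \+ (fun k => meval (u k) q)).
    exact: cvgD.
  by apply/funext => k; rewrite mevalD.
- rewrite mevalM (_ : (fun _ => _) =
    (fun k => meval (u k) p) \* (fun k => meval (u k) q)).
    exact: cvgM.
  by apply/funext => k; rewrite mevalM.
Qed.
End Limits.

Section Flow.
Local Open Scope classical_set_scope.
Local Open Scope ring_scope.
Variables (R : realType) (m : nat) (v : 'I_m -> mpoly m R).

(** The Picard iterates of t' = v(t) started at t.  As v is polynomial, every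
    iterate is a polynomial in time, and integration is formal. *)
Fixpoint picard (t : 'I_m -> R) (q : nat) : 'I_m -> {poly R} :=
  if q is q'.+1 then
    fun l => (t l)%:P + antideriv (along (picard t q') (v l))
  else fun l => (t l)%:P.

Lemma picard_at0 t q l : (picard t q l).[0] = t l.
Proof.
by case: q => [|q] /=; rewrite ?hornerD hornerC // antideriv0 addr0.
Qed.

Lemma deriv_picard t q l :
  (picard t q.+1 l)^`() = along (picard t q) (v l).
Proof. by rewrite /= derivD derivC add0r deriv_antideriv. Qed.

(** The value at time s of the q-th Picard iterate. *)
Definition picard_at t q s : 'I_m -> R := fun l => (picard t q l).[s].

Lemma horner_along_picard t q s p :
  (along (picard t q) p).[s] = meval (picard_at t q s) p.
Proof. exact: horner_along. Qed.

(** The derivative of p along the vector field v. *)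
Definition lie (p : mpoly m R) : mpoly m R := \sum_l mderiv l p * v l.

Variables (t0 : 'I_m -> R) (r : R).
Hypothesis r0 : 0 < r.

(** Membership in the closed ball about t0 for the sup norm. *)
Definition sup_ball (d : R) (t : 'I_m -> R) := forall l, `|t l - t0 l| <= d.

Lemma mpoly_bound (p : mpoly m R) : exists K : R,
  [/\ 0 <= K, forall t, sup_ball (2 * r) t -> `|meval t p| <= K &
   forall t t' d, sup_ball (2 * r) t -> sup_ball (2 * r) t' ->
     (forall l, `|t l - t' l| <= d) -> 0 <= d ->
     `|meval t p - meval t' p| <= K * d].
Proof.
pose rho := 2 * r + \sum_l `|t0 l|.
have nr t : sup_ball (2 * r) t -> forall l, `|t l| <= rho.
  move=> ht l; rewrite -(subrK (t0 l) (t l)) (le_trans (ler_normD _ _)) //.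
  apply: lerD; first exact: ht.
  by rewrite (bigD1 l) //= lerDl sumr_ge0.
have [K [K0 Kb Kl]] := meval_bounded_lipschitz p rho.
exists K; split => // [t /nr|t t' d /nr ht /nr ht']; first exact: Kb.
exact: Kl.
Qed.

Lemma mpoly_bound_family (I : finType) (f : I -> mpoly m R) : exists K : R,
  [/\ 0 <= K, forall i t, sup_ball (2 * r) t -> `|meval t (f i)| <= K &
   forall i t t' d, sup_ball (2 * r) t -> sup_ball (2 * r) t' ->
     (forall l, `|t l - t' l| <= d) -> 0 <= d ->
     `|meval t (f i) - meval t' (f i)| <= K * d].
Proof.
have /choice [k Hk] i := mpoly_bound (f i).
have k0 i : 0 <= k i by case: (Hk i).
have kle i : k i <= \sum_j k j by rewrite (bigD1 i) //= lerDl sumr_ge0.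
exists (\sum_i k i); split; first by rewrite sumr_ge0.
  move=> i t ht; apply: le_trans (kle i).
  by case: (Hk i) => _ + _; apply.
move=> i t t' d ht ht' htt d0; case: (Hk i) => _ _ H.
by apply: le_trans (H t t' d ht ht' htt d0) _; rewrite ler_wpM2r.
Qed.

Section Estimates.
Variables (K e : R).
Hypotheses (K0 : 0 <= K) (e0 : 0 < e) (Ker : K * e <= r)
  (Ke4 : 4 * (K * e) <= 1).
Hypothesis vb : forall l t, sup_ball (2 * r) t -> `|meval t (v l)| <= K.
Hypothesis vl : forall l t t' (d : R), sup_ball (2 * r) t -> sup_ball (2 * r) t' ->
     (forall l, `|t l - t' l| <= d) -> 0 <= d ->
     `|meval t (v l) - meval t' (v l)| <= K * d.

Lemma speed_bound (s : R) : `|s| <= e -> K * `|s| <= K * e.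
Proof. by move=> h; rewrite ler_wpM2l. Qed.

Lemma picard_displacement t q (s : R) l : sup_ball r t -> `|s| <= e ->
  `|picard_at t q s l - t l| <= K * `|s|.
Proof.
move=> ht; elim: q s l => [|q IH] s l se.
  by rewrite /picard_at /= hornerC subrr normr0 mulr_ge0.
rewrite /picard_at -(picard_at0 t q.+1 l).
apply: (poly_lipschitz0 _ se) => x xe.
rewrite deriv_picard horner_along_picard; apply: vb => k.
rewrite -(subrK (t k) (picard_at t q x k)) -addrA (le_trans (ler_normD _ _)) //.
have := IH x k xe; have := ht k; have := speed_bound xe; have := Ker; lra.
Qed.

Lemma picard_near t q (s : R) : sup_ball r t -> `|s| <= e ->
  sup_ball (2 * r) (picard_at t q s).
Proof.
move=> ht se k.
rewrite -(subrK (t k) (picard_at t q s k)) -addrA (le_trans (ler_normD _ _)) //.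
have := picard_displacement q k ht se; have := ht k.
by have := speed_bound se; have := Ker; lra.
Qed.

Lemma picard_step t q (s : R) l : sup_ball r t -> `|s| <= e ->
  `|picard_at t q.+1 s l - picard_at t q s l| <= r * 4^-1 ^+ q.
Proof.
move=> ht; elim: q s l => [|q IH] s l se.
  rewrite expr0 mulr1 {2}/picard_at /= hornerC.
  apply: (le_trans (picard_displacement 1 l ht se)).
  by apply: le_trans Ker; exact: speed_bound.
have D0 : 0 <= r * 4^-1 ^+ q by rewrite mulr_ge0 ?exprn_ge0 ?ltW.
rewrite exprSr mulrA; move: (r * 4^-1 ^+ q) D0 IH => D D0 IH.
pose P := picard t q.+2 l - picard t q.+1 l.
have P0 : P.[0] = 0 by rewrite hornerD hornerN !picard_at0 subrr.
have -> : picard_at t q.+2 s l - picard_at t q.+1 s l = P.[s] - P.[0].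
  by rewrite P0 subr0 hornerD hornerN.
apply: (@le_trans _ _ (K * D * `|s|)).
  apply: (poly_lipschitz0 _ se) => x xe.
  rewrite derivB !deriv_picard hornerD hornerN !horner_along_picard.
  by apply: vl => // [||k]; [exact: picard_near|exact: picard_near|exact: IH].
have := speed_bound se => h.
have : D * (4 * (K * `|s|)) <= D * 1 by rewrite ler_wpM2l //; move: h Ke4; lra.
by lra.
Qed.

(** On short time intervals every iterate is a translation up to a map with
    Lipschitz constant 1/2; this makes the flow expanding. *)
Lemma picard_contract t t' q (s : R) d l :
  sup_ball r t -> sup_ball r t' -> `|s| <= e ->
  (forall k, `|t k - t' k| <= d) ->
  `|(picard_at t q s l - picard_at t' q s l) - (t l - t' l)| <= d / 2.
Proof.
move=> ht ht' + htt.
have d0 : 0 <= d by exact: le_trans (htt l).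
elim: q s l => [|q IH] s l se.
  by rewrite /picard_at /= !hornerC subrr normr0; lra.
pose P := picard t q.+1 l - picard t' q.+1 l.
have -> : picard_at t q.+1 s l - picard_at t' q.+1 s l - (t l - t' l) = P.[s] - P.[0].
  by rewrite /P ![(_ - _).[_]]hornerD !hornerN !picard_at0.
apply: (@le_trans _ _ (K * (3 / 2 * d) * `|s|)).
  apply: (poly_lipschitz0 _ se) => x xe.
  rewrite derivB !deriv_picard hornerD hornerN !horner_along_picard.
  apply: vl => // [||k|]; [exact: picard_near|exact: picard_near| |lra].
  rewrite -(subrK (t k - t' k) (_ - _)) (le_trans (ler_normD _ _)) //.
  have := IH x k xe; have := htt k; lra.
have := speed_bound se => h.
have : d * (4 * (K * `|s|)) <= d * 1 by rewrite ler_wpM2l //; move: h Ke4; lra.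
by lra.
Qed.

Lemma picard_cvg t (s : R) l : sup_ball r t -> `|s| <= e ->
  cvgn (fun q => picard_at t q s l).
Proof.
move=> ht se; apply: (@cvgn_geometric _ _ r 4^-1) => //; first exact: ltW.
  by apply/andP; split; lra.
by move=> q; exact: picard_step.
Qed.

(** The flow of v at time s, defined as the limit of the Picard iterates. *)
Definition flow s t : 'I_m -> R := fun l => limn (fun q => picard_at t q s l).

Lemma flow_displacement t (s : R) l : sup_ball r t -> `|s| <= e ->
  `|flow s t l - t l| <= K * `|s|.
Proof.
move=> ht se; apply: (@cvgn_norm_le _ (fun q => picard_at t q s l - t l)).
  by apply: cvgB; [exact: picard_cvg|exact: cvg_cst].
by move=> q; exact: picard_displacement.
Qed.

Lemma flow_contract t t' (s : R) d l : sup_ball r t -> sup_ball r t' -> `|s| <= e ->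
  (forall k, `|t k - t' k| <= d) ->
  `|(flow s t l - flow s t' l) - (t l - t' l)| <= d / 2.
Proof.
move=> ht ht' se htt.
apply: (@cvgn_norm_le _
  (fun q => (picard_at t q s l - picard_at t' q s l) - (t l - t' l))).
  by do 2 ?apply: cvgB; first [exact: picard_cvg|exact: cvg_cst].
by move=> q; exact: picard_contract.
Qed.

Lemma flow_expanding t t' (s d : R) : sup_ball r t -> sup_ball r t' -> `|s| <= e ->
  (forall l, `|flow s t l - flow s t' l| <= d) ->
  forall l, `|t l - t' l| <= 2 * d.
Proof.
move=> ht ht' se hd l.
have d0 : 0 <= d by exact: le_trans (hd l).
pose D := \big[Num.max/0]_k `|t k - t' k|.
have hD k : `|t k - t' k| <= D by exact: le_bigmax.
have D0 : 0 <= D by exact: le_trans (hD l).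
suff : D <= d + D / 2 by have := hD l; lra.
apply: bigmax_le => [|k _]; first lra.
have := flow_contract k ht ht' se hD; have := hd k.
set a := flow s t k - _; set b := t k - _.
move=> h1 h2; rewrite -[b](subKr a) (le_trans (ler_normB _ _)) //; lra.
Qed.

(** If p grows at a rate at least k along the field v, then it does so along the
    flow.  No differentiability of the flow is needed: the derivative of p along
    the iterate of rank q+1 is computed with the velocity given by the iterate
    of rank q, and the two differ by a geometrically decreasing error. *)
Lemma flow_growth p (k : R) t s s' :
  (forall x, sup_ball (2 * r) x -> k <= meval x (lie p)) ->
  sup_ball r t -> - e <= s -> s <= s' -> s' <= e ->
  k * (s' - s) <= meval (flow s' t) p - meval (flow s t) p.
Proof.
move=> hk ht es ss' s'e.
have se : `|s| <= e by rewrite ler_norml es; lra.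
have se' : `|s'| <= e by rewrite ler_norml s'e andbT; lra.
have [L [L0 Lb Ll]] := mpoly_bound_family (fun l => mderiv l p).
pose C : R := m%:R * (L * r * K).
pose u q : R := meval (picard_at t q.+1 s') p - meval (picard_at t q.+1 s) p.
have hu q : (k - C * 4^-1 ^+ q) * (s' - s) <= u q.
  rewrite /u -!horner_along_picard; apply: (@poly_growth _ _ e) => // x xe.
  rewrite deriv_along horner_sum.
  under eq_bigr => l _ do
    rewrite hornerM deriv_picard !horner_along_picard.
  have nx := picard_near q ht xe; have nx' := picard_near q.+1 ht xe.
  have := hk _ nx; rewrite /lie raddf_sum /=.
  under eq_bigr => l _ do rewrite mevalM.
  set S := \sum_l _; set S' := \sum_l _ => kS.
  suff : `|S' - S| <= C * 4^-1 ^+ q by rewrite ler_norml; lra.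
  rewrite -sumrB (le_trans (ler_norm_sum _ _ _)) //.
  have -> : C * 4^-1 ^+ q = \sum_(l < m) (L * (r * 4^-1 ^+ q) * K).
    by rewrite sumr_const card_ord -mulr_natl /C; ring.
  apply: ler_sum => l _; rewrite -mulrBl normrM ler_pM ?vb //.
  apply: Ll => // [j|]; first exact: picard_step.
  by rewrite mulr_ge0 ?exprn_ge0 ?ltW.
have cm x : `|x| <= e ->
    (fun q => meval (picard_at t q.+1 x) p) @ \oo --> meval (flow x t) p.
  move=> xe; rewrite (cvg_shiftS (fun q => meval (picard_at t q x) p)).
  by apply: cvgn_meval => l; exact: picard_cvg.
have cu : u @ \oo --> meval (flow s' t) p - meval (flow s t) p.
  by apply: cvgB; exact: cm.
have cg : (fun q => (k - C * 4^-1 ^+ q) * (s' - s)) @ \oo --> (k - 0) * (s' - s).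
  apply: cvgM; last exact: cvg_cst.
  apply: cvgB; first exact: cvg_cst.
  have := @cvg_geometric R C 4^-1; apply.
  by rewrite ger0_norm //; lra.
rewrite subr0 in cg.
rewrite -(cvg_lim _ cg) // -(cvg_lim _ cu) //.
apply: ler_lim; [exact: cvgP cg|exact: cvgP cu|].
by apply: nearW.
Qed.
End Estimates.

(** Short-time properties of the flow near t0.  With k = 0, the last one applied
    to p and to - p says that the functions annihilated by v are constant along
    the flow. *)
Lemma flow_exists : exists (K e : R) (psi : R -> ('I_m -> R) -> 'I_m -> R),
  [/\ 0 <= K, 0 < e,
   forall t s l, sup_ball r t -> `|s| <= e -> `|psi s t l - t l| <= K * `|s|,
   forall t t' s d, sup_ball r t -> sup_ball r t' -> `|s| <= e ->
     (forall l, `|psi s t l - psi s t' l| <= d) ->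
     forall l, `|t l - t' l| <= 2 * d &
   forall p k t s s', (forall x, sup_ball (2 * r) x -> k <= meval x (lie p)) ->
     sup_ball r t -> - e <= s -> s <= s' -> s' <= e ->
     k * (s' - s) <= meval (psi s' t) p - meval (psi s t) p].
Proof.
have [K [K0 Kb Kl]] := mpoly_bound_family v.
pose e : R := Num.min (r / (K + 1)) (1 / (4 * (K + 1))).
have K1 : 0 < K + 1 by lra.
have e0 : 0 < e by rewrite lt_min !divr_gt0 // mulr_gt0.
have Ker : K * e <= r.
  have : e * (K + 1) <= r by rewrite -ler_pdivlMr // ge_min lexx.
  by move: e0; nra.
have Ke4 : 4 * (K * e) <= 1.
  have K4 : 0 < 4 * (K + 1) by lra.
  have : e * (4 * (K + 1)) <= 1 by rewrite -(ler_pdivlMr _ _ K4) ge_min lexx orbT.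
  by move: e0; nra.
(* flow s is a total function, but is meaningful for |s| <= e only. *)
exists K, e, flow; split => //.
- by move=> t s l ht se; apply: (@flow_displacement K e).
- by move=> t t' s d ht ht' se; apply: (@flow_expanding K e).
- by move=> p k t s s' hk ht; apply: (@flow_growth K e).
Qed.

End Flow.

(** * Polynomial maps with few components *)

Section Fractions.
Variable A : idomainType.
Local Notation tofrac := (@FracField.tofrac A).

Lemma fraction_denom (x : {fraction A}) :
  exists2 d : A, d != 0 & exists n : A, x * tofrac d = tofrac n.
Proof.
elim/quotW: x => x; exists (frac x).2; first exact: denom_ratioP.
exists (frac x).1; rewrite !piE; apply/eqP; rewrite piE.
rewrite FracField.equivfE /FracField.mulf.
rewrite !numden_Ratio ?mulf_neq0 ?oner_eq0 ?denom_ratioP //.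
by rewrite !mulr1 mulrC.
Qed.

Lemma common_denom (I : finType) (u : I -> {fraction A}) :
  exists2 d : A, d != 0 & exists w : I -> A, forall i, u i * tofrac d = tofrac (w i).
Proof.
have /choice [d Hd] i : exists d, d != 0 /\ exists n, u i * tofrac d = tofrac n.
  by have [d ? ?] := fraction_denom (u i); exists d.
have /choice [n Hn] i : exists n, u i * tofrac (d i) = tofrac n by case: (Hd i).
exists (\prod_i d i).
  by apply/prodf_neq0 => i _; case: (Hd i).
exists (fun i => n i * \prod_(j | j != i) d j) => i.
by rewrite (bigD1 i) //= !tofracM mulrA Hn.
Qed.

(** The generic rank of a matrix of polynomials is at least its rank at any
    point: a constant change of bases isolates a minor that is 1 at this point,
    hence is a nonzero polynomial. *)
Lemma rank_tofrac_ge (F : fieldType) (phi : {rmorphism A -> F})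
    (iota : F -> A) (p q : nat) (M : 'M[A]_(p, q)) :
  cancel iota phi ->
  (\rank (map_mx phi M) <= \rank (map_mx tofrac M))%N.
Proof.
move=> iotaK; set B := map_mx phi M; set r := \rank B.
pose P : 'M[F]_(r, p) := pid_mx r *m invmx (col_ebase B).
pose Q : 'M[F]_(q, r) := invmx (row_ebase B) *m pid_mx r.
have PBQ : P *m B *m Q = 1%:M.
  rewrite -{1}(mulmx_ebase B) /P /Q !mulmxA mulmxKV ?col_ebase_unit //.
  rewrite mulmxK ?row_ebase_unit // !mul_pid_mx !minnn.
  rewrite (minn_idPr (rank_leq_row B)) minnn (minn_idPr (rank_leq_col B)).
  exact: pid_mx_1.
pose D := map_mx iota P *m M *m map_mx iota Q.
have phiD : map_mx phi D = 1%:M.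
  rewrite !map_mxM /= -!map_mx_comp -[RHS]PBQ.
  by congr (_ *m _ *m _); apply/matrixP => i j; rewrite !mxE /= iotaK.
have detD : \det D != 0.
  have := congr1 (fun X => \det X) phiD; rewrite det_map_mx det1.
  by apply: contra_eq_neq => ->; rewrite rmorph0 eq_sym oner_neq0.
have unitD : map_mx tofrac D \in unitmx.
  by rewrite unitmxE det_map_mx unitfE tofrac_eq0.
have <- : \rank (map_mx tofrac D) = r by rewrite mxrank_unit.
rewrite !map_mxM /=; apply: leq_trans (mxrankM_maxl _ _) _.
exact: mxrankM_maxr.
Qed.

End Fractions.

Section Core.
Local Open Scope classical_set_scope.
Local Open Scope ring_scope.
Variables (R : realType) (m N r : nat).
Variables (c : 'I_N -> mpoly m R) (f : 'I_r -> mpoly m R) (t1 : 'I_m -> R).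

(** When the Jacobian of f has rank more than N at some point, some polynomial
    vector field annihilates the N functions c but not all of f.  It comes from
    the kernel of the Jacobian of c over the field of rational functions, by
    clearing denominators. *)
Lemma fiber_vector_field :
  (N < \rank (\matrix_(l < m, b < r) meval t1 (mderiv l (f b))))%N ->
  exists (v : 'I_m -> mpoly m R) (b : 'I_r),
    (forall a, lie v (c a) = 0) /\ lie v (f b) != 0.
Proof.
move=> Nr.
pose Mf : 'M[mpoly m R]_(m, r) := \matrix_(l, b) mderiv l (f b).
pose Mc : 'M[mpoly m R]_(m, N) := \matrix_(l, a) mderiv l (c a).
have : (N < \rank (map_mx (@FracField.tofrac _) Mf))%N.
  apply: leq_trans Nr _.
  have := @rank_tofrac_ge _ _ (meval t1) (@mpolyC m R) _ _ Mf (mevalC t1).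
  rewrite (_ : map_mx (meval t1) Mf = \matrix_(l, b) meval t1 (mderiv l (f b))) //.
  by apply/matrixP => l b; rewrite !mxE.
set KMf := map_mx _ Mf; set KMc := map_mx (@FracField.tofrac _) Mc => rKf.
have /matrixP nz : ~ (kermx KMc *m KMf = 0).
  move=> /mulmx0_rank_max; rewrite mxrank_ker => h.
  move: rKf; rewrite ltnNge => /negP; apply.
  apply: leq_trans (rank_leq_col KMc).
  have := rank_leq_row KMc; move: h; lia.
have [x [b xb]] : exists x b, (kermx KMc *m KMf) x b != 0.
  apply: contrapT => H; apply: nz => x b; rewrite [RHS]mxE.
  by apply/eqP; apply: contraT => h; case: H; exists x, b.
move: (mulmx_ker KMc) xb; move: (kermx KMc) => Z ZKMc xb.
pose u l := Z x l.
have uc a : \sum_l u l * FracField.tofrac (mderiv l (c a)) = 0.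
  have /matrixP/(_ x a) := ZKMc; rewrite !mxE => H; rewrite -[RHS]H.
  by apply: eq_bigr => l _; rewrite !mxE.
have uf : \sum_l u l * FracField.tofrac (mderiv l (f b)) != 0.
  move: xb; rewrite mxE; apply: contra_neq => H; rewrite -[RHS]H.
  by apply: eq_bigr => l _; rewrite !mxE.
have [d d0 [w uw]] := common_denom u.
have lieE p : FracField.tofrac (lie w p) =
    (\sum_l u l * FracField.tofrac (mderiv l p)) * FracField.tofrac d.
  rewrite rmorph_sum mulr_suml; apply: eq_bigr => l _ /=.
  by rewrite tofracM -uw; ring.
exists w, b; split => [a|].
  by apply/eqP; rewrite -tofrac_eq0 lieE uc mul0r.
have dK : FracField.tofrac d != 0 by rewrite tofrac_eq0.
by have := mulf_neq0 uf dK; rewrite -lieE tofrac_eq0.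
Qed.

Lemma lieN (v : 'I_m -> mpoly m R) p : lie (fun l => - v l) p = - lie v p.
Proof. by rewrite /lie -sumrN; apply: eq_bigr => l _; rewrite mulrN. Qed.

Lemma lie_oppr (v : 'I_m -> mpoly m R) p : lie v (- p) = - lie v p.
Proof.
by rewrite /lie -sumrN; apply: eq_bigr => l _; rewrite mderivN mulNr.
Qed.

Lemma fiber_vector_field_pos :
  (N < \rank (\matrix_(l < m, b < r) meval t1 (mderiv l (f b))))%N ->
  exists (v : 'I_m -> mpoly m R) (b : 'I_r) (t0 : 'I_m -> R),
    (forall a, lie v (c a) = 0) /\ 0 < meval t0 (lie v (f b)).
Proof.
move=> /fiber_vector_field [v [b [vc /mpoly_neq0_eval [t0 vf]]]].
have [h|h] := ltP 0 (meval t0 (lie v (f b))); first by exists v, b, t0.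
exists (fun l => - v l), b, t0; split => [a|].
  by rewrite lieN vc oppr0.
by rewrite lieN mevalN oppr_gt0 lt_neqAle vf.
Qed.

(** Moving along the fibers of c: near some point t0 there are maps psi s, for
    small times s, which preserve c, are expanding, and along which some
    coordinate of f strictly increases. *)
Lemma fiber_flow :
  (N < \rank (\matrix_(l < m, b < r) meval t1 (mderiv l (f b))))%N ->
  exists (b : 'I_r) (t0 : 'I_m -> R) (rho K e k : R)
    (psi : R -> ('I_m -> R) -> 'I_m -> R),
  [/\ [/\ 0 < rho, 0 <= K, 0 < e & 0 < k],
   forall t s l, sup_ball t0 rho t -> `|s| <= e -> `|psi s t l - t l| <= K * `|s|,
   forall t t' s d, sup_ball t0 rho t -> sup_ball t0 rho t' -> `|s| <= e ->
     (forall l, `|psi s t l - psi s t' l| <= d) ->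
     forall l, `|t l - t' l| <= 2 * d,
   forall a t s, sup_ball t0 rho t -> `|s| <= e ->
     meval (psi s t) (c a) = meval t (c a) &
   forall t s s', sup_ball t0 rho t -> - e <= s -> s <= s' -> s' <= e ->
     k * (s' - s) <= meval (psi s' t) (f b) - meval (psi s t) (f b)].
Proof.
move=> /fiber_vector_field_pos [v [b [t0 [vc vf]]]].
have [L [L0 _ Ll]] := mpoly_bound t0 1 (lie v (f b)).
set g := meval t0 _ in vf.
pose rho : R := Num.min 1 (g / (4 * (L + 1))).
have L4 : 0 < 4 * (L + 1) by lra.
have rho0 : 0 < rho by rewrite lt_min ltr01 divr_gt0.
have rho1 : rho <= 1 by rewrite ge_min lexx.
have rhoL : rho * (4 * (L + 1)) <= g by rewrite -(ler_pdivlMr _ _ L4) ge_min lexx orbT.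
have [K [e [psi [K0 e0 disp expa grow]]]] := flow_exists v t0 rho0.
have psi0 t : sup_ball t0 rho t -> psi 0 t = t.
  move=> ht; apply/funext => l; apply/eqP.
  rewrite -subr_eq0 -normr_le0; have := disp t 0 l ht.
  by rewrite normr0 mulr0; apply; exact: ltW.
exists b, t0, rho, K, e, (g / 2), psi; split => //.
- by split => //; rewrite divr_gt0.
- move=> a t s ht /[dup] se; rewrite ler_norml => /andP[es s_e].
  have mono p x y : lie v p = 0 -> - e <= x -> x <= y -> y <= e ->
      meval (psi x t) p <= meval (psi y t) p.
    move=> p0 ex xy ye; rewrite -subr_ge0.
    have := grow p 0 t x y; rewrite p0 mul0r; apply => // z _.
    by rewrite meval0.
  have const x y : - e <= x -> x <= y -> y <= e ->
      meval (psi x t) (c a) = meval (psi y t) (c a).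
    move=> ex xy ye; apply: le_anti; rewrite mono //=.
    by rewrite -lerN2 -!mevalN mono // lie_oppr vc oppr0.
  rewrite -{2}(psi0 t ht).
  have [s0|s0] := leP 0 s; last by apply: const => //; lra.
  by symmetry; apply: const => //; lra.
- move=> t s s' ht; apply: grow => // x hx.
  have n0 : sup_ball t0 (2 * 1) t0 by move=> l; rewrite subrr normr0; lra.
  have nx : sup_ball t0 (2 * 1) x by move=> l; apply: le_trans (hx l) _; lra.
  have := Ll x t0 (2 * rho) nx n0 hx; rewrite -/g ler_norml => h.
  have /h /andP[+ _] : 0 <= 2 * rho by lra.
  by move: rhoL; nra.
Qed.

End Core.

Section Conclusions.
Local Open Scope classical_set_scope.
Local Open Scope ring_scope.
Variables (R : realType) (m N : nat) (T : Type).
Variables (c : 'I_N -> mpoly m R) (C : 'rV[R]_m -> T).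
Local Notation ev t p := (meval (fun l => t ord0 l) p).
Hypothesis Cc : forall t t' : 'rV[R]_m,
  (forall a, ev t (c a) = ev t' (c a)) -> C t = C t'.

(** If a map C factors through the N polynomials c and the Jacobian of f has
    rank more than N at some point, then some coordinate of f is not locally
    identifiable from C. *)
Lemma not_locally_identifiable_from (r : nat) (f : 'I_r -> mpoly m R) t1 :
  (N < \rank (\matrix_(l < m, b < r) meval t1 (mderiv l (f b))))%N ->
  exists b, ~ locally_identifiable_from C (fun t : 'rV[R]_m => ev t (f b)).
Proof.
move=> /(@fiber_flow _ _ _ _ c) [b [t0 [rho [K [e [k [psi
  [[rho0 K0 e0 k0] disp expa const grow]]]]]]]].
exists b => -[Phi [Phifin [N0 N0null HPhi]]].
pose lo : 'rV[R]_m := \row_l (t0 l - rho).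
pose hi : 'rV[R]_m := \row_l (t0 l + rho).
have nbox t : box lo hi t -> sup_ball t0 rho (t ord0).
  move=> ht l; have := ht l; rewrite !mxE ler_norml => /andP[? ?].
  by apply/andP; split; lra.
(* Infinitely many times, all admissible. *)
pose s (j : nat) : R := e / j.+1%:R.
have s0 j : 0 < s j by rewrite divr_gt0 // ltr0n.
have se j : s j <= e by rewrite ler_pdivrMr ?ltr0n // ler_peMr ?(ltW e0) // ler1n.
have sn j : `|s j| <= e by rewrite gtr0_norm.
pose phi j (t : 'rV[R]_m) : 'rV[R]_m := \row_l psi (s j) (t ord0) l.
have ephi j : expanding_on (box lo hi) (phi j).
  move=> t t' /nbox ht /nbox ht' d hd; apply: (expa _ _ (s j)) => // l.
  by have := hd l; rewrite !mxE.
have lohi l : lo ord0 l < hi ord0 l by rewrite !mxE; lra.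
have [t /nbox bt tN] := box_avoid lohi N0null ephi.
have evphi j p : ev (phi j t) p = meval (psi (s j) (t ord0)) p.
  by apply: meval_eq => l; rewrite mxE.
have Cphi j : C (phi j t) = C t.
  by apply: Cc => a; rewrite evphi const.
have Pphi j : Phi (C t) (ev (phi j t) (f b)) by rewrite -(Cphi j); exact: HPhi.
have inj : injective (fun j => ev (phi j t) (f b)).
  have mono i j : s i < s j -> ev (phi i t) (f b) < ev (phi j t) (f b).
    move=> ij; rewrite !evphi -subr_gt0.
    apply: lt_le_trans (grow _ _ _ bt _ (ltW ij) (se j)).
      by rewrite mulr_gt0 // subr_gt0.
    by have := s0 i; lra.
  move=> i j /= Eij; have [/mono|/mono|] := ltgtP (s i) (s j); rewrite ?Eij ?ltxx //.
  move=> /(mulfI (lt0r_neq0 e0)) /invr_inj /eqP; rewrite eqr_nat => /eqP [].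
  by [].
apply: infinite_nat.
apply: (@sub_finite_set _ _ ((fun j => ev (phi j t) (f b)) @^-1` Phi (C t))).
  by move=> j _; exact: Pphi.
apply: finite_preimage => // i j _ _; exact: inj.
Qed.

(** A map that factors through fewer polynomials than there are variables is
    not generically locally injective. *)
Lemma not_generically_locally_injective : (N < m)%N ->
  ~ generically_locally_injective C.
Proof.
move=> Nm [N0 N0null Hinj].
have : (N < \rank (\matrix_(l < m, b < m) meval (fun=> 0%R : R) (mderiv l (mpvar R b))))%N.
  rewrite (_ : (\matrix_(l, b) _) = 1%:M) ?mxrank1 //.
  apply/matrixP => l b; rewrite !mxE /mpvar mderivX mevalZ mnm1E.
  rewrite [l == b]eq_sym; case: eqVneq => [->|_]; last by rewrite mul0r.
  by rewrite mul1r -[X in mnm_sub X]add0m addmK mpolyX0 meval1.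
move=> /(@fiber_flow _ _ _ _ c) [b [t0 [rho [K [e [k [psi
  [[rho0 K0 e0 k0] disp _ const grow]]]]]]]].
pose lo : 'rV[R]_m := \row_l (t0 l - rho).
pose hi : 'rV[R]_m := \row_l (t0 l + rho).
have nbox t : box lo hi t -> sup_ball t0 rho (t ord0).
  move=> ht l; have := ht l; rewrite !mxE ler_norml => /andP[? ?].
  by apply/andP; split; lra.
have lohi l : lo ord0 l < hi ord0 l by rewrite !mxE; lra.
have eid j : expanding_on (box lo hi) ((fun (_ : nat) t => t) j).
  move=> t t' _ _ d hd l; apply: le_trans (hd l) _.
  by have := le_trans (normr_ge0 _) (hd l); lra.
have [t /nbox bt /(_ 0%N) tN] := box_avoid lohi N0null eid.
have [U tU Uinj] := Hinj t tN.
have /nbhs_ballP [d /= d0 dU] := tU.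
pose s : R := Num.min e (d / 2 / (K + 1)).
have K1 : 0 < K + 1 by lra.
have s0 : 0 < s by rewrite lt_min e0 !divr_gt0.
have se : s <= e by rewrite ge_min lexx.
have sn : `|s| <= e by rewrite gtr0_norm.
have sK : s * (K + 1) <= d / 2 by rewrite -ler_pdivlMr // ge_min lexx orbT.
pose t' : 'rV[R]_m := \row_l psi s (t ord0) l.
have t'U : U t'.
  apply: dU; split => // i l; rewrite !ord1 /ball /= !mxE distrC.
  apply: le_lt_trans (disp _ _ _ bt sn) _.
  by rewrite gtr0_norm //; move: s0 K0 d0 sK; nra.
have Ett' : t' = t.
  apply: Uinj; rewrite ?inE //; first exact: nbhs_singleton tU.
  apply: Cc => a; apply: etrans (const a (t ord0) s bt sn).
  by apply: meval_eq => l; rewrite mxE.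
have psi0 l : psi 0 (t ord0) l = t ord0 l.
  apply/eqP; rewrite -subr_eq0 -normr_le0; have := disp _ 0 l bt.
  by rewrite normr0 mulr0; apply; exact: ltW.
have := grow (t ord0) 0 s bt; rewrite /mpvar !mevalXU psi0 subr0.
have -> : psi s (t ord0) b = t ord0 b by have /rowP/(_ b) := Ett'; rewrite mxE.
rewrite subrr => /(_ _ (ltW s0) se) h.
have /h : - e <= 0 by lra.
by rewrite leNgt mulr_gt0.
Qed.

End Conclusions.

(** * Paths, cycles and potentials *)

Section PathEdges.
Variable n : nat.
Implicit Types (E : {set 'I_n * 'I_n}) (v w x y : 'I_n) (p c : seq 'I_n).

Lemma path_edges_cat v p1 p2 :
  path_edges v (p1 ++ p2) = path_edges v p1 ++ path_edges (last v p1) p2.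
Proof.
by elim: p1 v => [|a p1 IH] v //; rewrite /path_edges /= in IH *; rewrite IH.
Qed.

Lemma cycle_edges_cons y p : cycle_edges (y :: p) = path_edges y (rcons p y).
Proof.
rewrite /cycle_edges rot1_cons /path_edges.
suff H v : zip (v :: p) (rcons p y) = zip (v :: rcons p y) (rcons p y).
  exact: H.
by elim: p v => [|a p IH] v //=; rewrite -IH.
Qed.

Lemma path_edges_sub E v p : path (edge_rel E) v p ->
  {subset path_edges v p <= E}.
Proof.
elim: p v => [|a p IH] v //= /andP[va pp] x.
by rewrite inE => /orP[/eqP ->|] //; exact: IH pp x.
Qed.

Lemma cycle_edges_sub E c : cycle (edge_rel E) c ->
  {subset cycle_edges c <= E}.
Proof. by case: c => [|y p] //; rewrite cycle_edges_cons; exact: path_edges_sub. Qed.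

Lemma mem_path_edges v p x y : (x, y) \in path_edges v p ->
  x \in v :: p /\ y \in v :: p.
Proof.
elim: p v => [|a p IH] v //=; rewrite inE => /orP[/eqP[-> ->]|/IH[xp yp]].
  by rewrite !inE !eqxx orbT.
by rewrite in_cons xp in_cons yp !orbT.
Qed.

Lemma dipath_size E v p w : dipath E v p w -> (size p < n)%N.
Proof.
case=> _ /card_uniqP; rewrite /= => <- _.
by rewrite -[X in (_ <= X)%N](card_ord n) max_card.
Qed.

Lemma dipath_of_path E v p : path (edge_rel E) v p ->
  exists2 q, dipath E v q (last v p) & (size q <= size p)%N.
Proof.
move=> pp; case: (shortenP pp) => q pq uq sub.
exists q => //; apply: uniq_leq_size => //.
by case/andP: uq.
Qed.

(** The set of vertices reachable from i is closed under following edges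
    backwards: if an edge y -> x ends in it, then y is reached either around a
    cycle through the edge or along a path that starts at i. *)
Lemma all_reachable E i j : strongly_io_connected E [set i] [set j] ->
  forall v, exists p, dipath E i p v.
Proof.
move=> [wc io] v.
suff : connect (edge_rel E) i v.
  by move=> /connectP[p pp ->]; have [q hq _] := dipath_of_path pp; exists q.
have /connectP[p + ->] := wc i v.
elim/last_ind: p => [|p y IH]; first by rewrite connect0.
rewrite rcons_path last_rcons => /andP[/IH {}IH /orP[xy|yx]].
  by apply: connect_trans IH _; exact: connect1.
move: (last i p) IH yx => x ix yx.
have [[[|z c] [[_ _ cc] yxc]]|[i' [j' [q [+ _ [pq _ _]]]]]] := io _ yx.
- by rewrite /cycle_edges in yxc.
- rewrite cycle_edges_cons in yxc.
  have [] := mem_path_edges yxc; rewrite !inE !mem_rcons !inE !orbA !orbb -!in_cons.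
  move=> yc xc; apply: connect_trans ix _.
  exact: connect_cycle cc _ _ xc yc.
- rewrite inE => /eqP E1; rewrite E1 in pq *.
  move=> /mem_path_edges [yq _].
  exact: path_connect pq _ yq.
Qed.

End PathEdges.

Section Potential.
Variables (R : realDomainType) (n : nat) (E : {set 'I_n * 'I_n}) (i j : 'I_n).
Variable wt : 'I_n * 'I_n -> R.
Hypothesis io : forall x, x \in E -> on_cycle_or_io_path E [set i] [set j] x.
Hypothesis reach : forall v, exists p, dipath E i p v.
Hypothesis wt_cycle : forall c, dicycle E c -> \sum_(x <- cycle_edges c) wt x = 0.
Hypothesis wt_path :
  forall p, dipath E i p j -> \sum_(x <- path_edges i p) wt x = 0.

Local Notation pwt v p := (\sum_(x <- path_edges v p) wt x).

Lemma min_weight_path v : exists p, dipath E i p v /\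
  forall q, dipath E i q v -> pwt i p <= pwt i q.
Proof.
have [p0 hp0] := reach v.
pose ok (p : seq 'I_n) := [&& path (edge_rel E) i p, uniq (i :: p) & last i p == v].
have okP p : reflect (dipath E i p v) (ok p).
  apply: (iffP and3P) => -[? ? H]; split=> //; exact/eqP.
have sz p : dipath E i p v -> (size p <= n)%N by move=> /dipath_size /ltnW.
have H0 : ok (Bseq (sz _ hp0)) by apply/okP.
case: (Order.TotalTheory.arg_minP (fun p : n.-bseq 'I_n => pwt i p)
  (P := fun p : n.-bseq 'I_n => ok p) H0) => p /okP hp pmin.
exists (val p); split => // q hq.
by have := pmin (Bseq (sz _ hq)); apply; apply/okP.
Qed.

Lemma sum_telescope (h : 'I_n -> R) v p :
  \sum_(x <- path_edges v p) (wt x + h x.1 - h x.2) =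
    pwt v p + h v - h (last v p).
Proof.
elim: p v => [|a p IH] v; first by rewrite !big_nil; ring.
by rewrite /path_edges /= !big_cons -/(path_edges a p) IH /=; ring.
Qed.

(** An edge weighting whose sum over every cycle and over every path from i to j
    is zero is a coboundary.  The potential h v is the least weight of a path
    from i to v.  Then wt x + h x.1 - h x.2 is nonnegative on every edge, and
    its sum over a cycle or over a path from i to j is zero. *)
Lemma potential : exists h : 'I_n -> R, [/\ h i = 0, h j = 0 &
  forall x, x \in E -> wt x = h x.2 - h x.1].
Proof.
have /choice [P HP] := min_weight_path.
pose h v := pwt i (P v).
have hle v q : dipath E i q v -> h v <= pwt i q by case: (HP v) => _; apply.
exists h.
have hi : h i = 0.
  have [[_ u l] _] := HP i; rewrite /h.
  case/lastP: (P i) u l => [|q z]; first by rewrite big_nil.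
  by rewrite last_rcons => + zi; rewrite zi /= mem_rcons inE eqxx.
have hj : h j = 0 by rewrite /h wt_path //; case: (HP j).
split => //.
have d_ge0 x : x \in E -> 0 <= wt x + h x.1 - h x.2.
  case: x => x y /= xy; rewrite subr_ge0 addrC.
  have [[]] := HP x; rewrite [h x]/h; move: (P x) => q px ux lx _.
  (* A path to x followed by the edge x -> y either is a path to y, or closes
     a cycle, of weight zero, whose removal leaves a path to y. *)
  have [yq|ny] := boolP (y \in i :: q).
    move: px ux lx; case/splitPl: yq => p1 p2 l1.
    rewrite cat_path last_cat l1 -cat_cons cat_uniq.
    move=> /andP[px1 px2] /and3P[u1 /hasPn disj u2] lx.
    rewrite path_edges_cat big_cat l1 /=.
    have hp1 : dipath E i p1 y by split.
    have := hle _ _ hp1; rewrite /h => le1.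
    have cyc : dicycle E (y :: p2).
      split => //=.
        rewrite u2 andbT; apply/negP => yp2.
        by have := disj _ yp2; rewrite -l1 mem_last.
      by rewrite rcons_path px2 /= lx.
    have := wt_cycle cyc.
    rewrite cycle_edges_cons -cats1 path_edges_cat big_cat /= lx.
    rewrite {3}/path_edges /= big_seq1 => ?.
    by move: le1; rewrite /h; lra.
  have hp : dipath E i (rcons q y) y.
    split; last by rewrite last_rcons.
      by rewrite rcons_path px lx.
    by rewrite -rcons_cons rcons_uniq ny.
  have := hle _ _ hp.
  by rewrite -cats1 path_edges_cat big_cat /= lx {2}/path_edges /= big_seq1.
have zero s : {subset s <= E} -> \sum_(x <- s) (wt x + h x.1 - h x.2) = 0 ->
    forall x, x \in s -> wt x = h x.2 - h x.1.
  move=> sE; rewrite big_seq => /eqP.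
  rewrite psumr_eq0 => [/allP H x xs|x /sE]; last exact: d_ge0.
  by have := H x xs; rewrite xs /= => /eqP; lra.
move=> x /io [[[|y c] [cyc xc]]|[i' [j' [p [+ + hp xp]]]]].
- by rewrite /cycle_edges in xc.
- have [_ _ /cycle_edges_sub cE] := cyc.
  apply: (zero _ cE) => //.
  have := wt_cycle cyc; rewrite cycle_edges_cons => w0.
  by rewrite sum_telescope w0 last_rcons; ring.
- rewrite !inE => /eqP Ei /eqP Ej; rewrite Ei Ej in hp xp.
  have [/path_edges_sub pE _ lp] := hp.
  apply: (zero _ pE) => //.
  by rewrite sum_telescope wt_path // lp hi hj; ring.
Qed.

End Potential.

(** * Coefficients of compartmental models *)

Section Degree.
Variables (F : comNzRingType) (n : nat) (A : 'M[F]_n) (i : 'I_n).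
Variable E : {set 'I_n * 'I_n}.
Hypothesis AE : forall v u, A v u != 0 -> v = u \/ (u, v) \in E.

Local Notation W d v := ((cofactor (char_poly_mx A) i v)`_d).

(** Comparison of coefficients in column i of (X - A) adj(X - A) = det(X - A). *)
Lemma cofactor_rec d v :
  W d v = \sum_u A v u * W d.+1 u + (char_poly A)`_d.+1 *+ (v == i).
Proof.
have /matrixP/(_ v i) := mul_mx_adj (char_poly_mx A).
rewrite !mxE => /(congr1 (fun p : {poly F} => p`_d.+1)).
rewrite coefMn -/(char_poly A) => <-.
rewrite coef_sum.
have ME u : char_poly_mx A v u = 'X *+ (v == u) - (A v u)%:P by rewrite !mxE.
under [X in _ = _ + X]eq_bigr => u _ do
  rewrite ME [\adj _ _ _]mxE mulrBl coefB coefCM.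
rewrite -big_split /=.
rewrite (bigD1 v) //= eqxx mulr1n coefXM /= big1 ?addr0; first by ring.
by move=> u uv; rewrite eq_sym (negbTE uv) mul0r coef0; ring.
Qed.

Lemma cofactor_high d v : (n <= d)%N -> W d v = 0.
Proof.
pose B := (\sum_u size (cofactor (char_poly_mx A) i u))%N.
have szB u : (size (cofactor (char_poly_mx A) i u) <= B)%N.
  by rewrite /B (bigD1 u) //= leq_addr.
suff H x : (B <= d + x)%N -> (n <= d)%N -> W d v = 0.
  by apply: (H B); rewrite leq_addl.
elim: x d v => [|x IH] d v.
  by rewrite addn0 => Bd _; rewrite nth_default // (leq_trans (szB v)).
rewrite addnS -addSn => Bd nd; rewrite cofactor_rec big1 ?add0r.
  by rewrite nth_default ?mul0rn // size_char_poly ltnS.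
by move=> u _; rewrite IH ?mulr0 // leqW.
Qed.

(** A coefficient of degree at least n - e of the cofactor (i, v) vanishes
    unless there is a walk of length less than e from i to v.  Following the
    recursion down from degree n, each step multiplies by A, that is, prolongs a
    walk by at most one edge. *)
Lemma cofactor_walk e d v : (n <= d + e)%N -> W d v != 0 ->
  exists p, [/\ path (edge_rel E) i p, last i p = v & (size p < e)%N].
Proof.
elim: e d v => [|e IH] d v.
  by rewrite addn0 => nd; rewrite cofactor_high ?eqxx.
rewrite addnS -addSn => nd; rewrite cofactor_rec.
have [->|vi] := eqVneq v i; first by exists [::].
rewrite mulr0n addr0 => nz.
have [u Hu] : exists u, A v u * W d.+1 u != 0.
  apply/existsP; apply: contraT; rewrite negb_exists => /forallP h.
  by rewrite big1 ?eqxx // in nz => u _; apply/eqP; have := h u; rewrite negbK.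
have Avu : A v u != 0 by apply: contra_neq Hu => ->; rewrite mul0r.
have Wu : W d.+1 u != 0 by apply: contra_neq Hu => ->; rewrite mulr0.
have [p [pp lp sp]] := IH _ _ nd Wu.
have [->|uv] := AE Avu; first by exists p; split => //; exact: ltnW.
exists (rcons p v); split; last by rewrite size_rcons.
  by rewrite rcons_path pp lp.
by rewrite last_rcons.
Qed.

Lemma cofactor_no_path j k d :
  (forall p, dipath E i p j -> (k < size p)%N) ->
  (n <= d + k.+1)%N -> W d j = 0.
Proof.
move=> nop nd; apply/eqP; apply: contraT => /(cofactor_walk nd) [p [pp lp sp]].
have [q hq sq] := dipath_of_path pp; rewrite lp in hq.
by have := nop q hq; rewrite ltnNge (leq_trans sq).
Qed.
End Degree.

Section Coefficients.
Variables (R : realType) (n m : nat) (E : {set 'I_n * 'I_n}) (i j : 'I_n).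
Variables (k : nat) (P : 'M[mpoly m R]_n) (A : 'rV[R]_m -> 'M[R]_n).
Local Notation ev t := (meval (fun l => t ord0 l)).
Hypothesis AP : forall t : 'rV[R]_m, A t = map_mx (ev t) P.
Hypothesis AE : forall t v u, A t v u != 0 -> v = u \/ (u, v) \in E.
Hypothesis nop : forall p, dipath E i p j -> (k < size p)%N.

(** The coefficients that can vary: the n nonleading ones of det(X - A), and
    those of degree less than n - 1 - k of the cofactor (i, j), as polynomials
    in the parameters. *)
Definition coef_polys (a : 'I_(n + (n - k.+1))) : mpoly m R :=
  match fintype.split a with
  | inl d => (char_poly P)`_d
  | inr d => (cofactor (char_poly_mx P) i j)`_d
  end.

Lemma char_poly_ev t d : (char_poly (A t))`_d = ev t (char_poly P)`_d.
Proof. by rewrite AP -map_char_poly coef_map. Qed.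

Lemma cofactor_ev t d : (cofactor (char_poly_mx (A t)) i j)`_d =
  ev t (cofactor (char_poly_mx P) i j)`_d.
Proof. by rewrite AP -map_char_poly_mx cofactor_map_mx coef_map. Qed.

(** Without a path from i to j of length at most k, the coefficient map factors
    through these 2n - 1 - k polynomials. *)
Lemma coef_map_polys (t t' : 'rV[R]_m) :
  (forall a, ev t (coef_polys a) = ev t' (coef_polys a)) ->
  Defs.coef_map [set i] [set j] A t = Defs.coef_map [set i] [set j] A t'.
Proof.
move=> H; apply/funext => -[[[[j' hj] o] d] hc]; rewrite /Defs.coef_map /=.
move: (hj); rewrite inE => /eqP Ej; case: o {hc} => [[i' hi]|] /=.
  move: (hi); rewrite inE => /eqP Ei; subst i' j'.
  have [dk|dk] := ltnP d (n - k.+1); last first.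
    have nd : (n <= d + k.+1)%N by lia.
    by rewrite !(fun s => cofactor_no_path (@AE s) nop nd).
  rewrite !cofactor_ev.
  have := H (rshift n (Ordinal dk)); rewrite /coef_polys.
  by rewrite -[rshift _ _]/(unsplit (inr _)) unsplitK.
have [dn|dn] := ltnP d n; last first.
  have -> : (d : nat) = n by have := ltn_ord d; lia.
  have mon (B : 'M[R]_n) : (char_poly B)`_n = 1.
    by have /monicP := char_poly_monic B; rewrite /lead_coef size_char_poly.
  by rewrite !mon.
rewrite !char_poly_ev.
have := H (lshift _ (Ordinal dn)); rewrite /coef_polys.
by rewrite -[lshift _ _]/(unsplit (inl _)) unsplitK.
Qed.

End Coefficients.

Section Models.
Variables (R : realType) (n : nat) (E : {set 'I_n * 'I_n}) (L : {set 'I_n}).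
Local Notation m := #|param E L|.
Local Notation ev t := (meval (fun l => t ord0 l)).

(** The parameter of an edge, as a polynomial (0 if x is not an edge). *)
Definition edge_poly (x : 'I_n * 'I_n) : mpoly m R :=
  if insub x : option {x | x \in E} is Some y
  then mpvar R (enum_rank (inl y : param E L)) else 0.

(** The parameter of a vertex of L, as a polynomial (0 outside L). *)
Definition vertex_poly (v : 'I_n) : mpoly m R :=
  if insub v : option {v | v \in L} is Some y
  then mpvar R (enum_rank (inr y : param E L)) else 0.

Lemma ev_edge_poly (t : pspace R E L) x : ev t (edge_poly x) = edge_param t x.
Proof.
by rewrite /edge_poly /edge_param; case: insub => [y|];
  rewrite ?meval0 // /mpvar mevalXU.
Qed.

Lemma ev_vertex_poly (t : pspace R E L) v : ev t (vertex_poly v) = vertex_param t v.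
Proof.
by rewrite /vertex_poly /vertex_param; case: insub => [y|];
  rewrite ?meval0 // /mpvar mevalXU.
Qed.

Lemma edge_param0 (t : pspace R E L) x : x \notin E -> edge_param t x = 0.
Proof. by move=> xE; rewrite /edge_param insubN. Qed.

(** The matrices of the two parametrizations, with polynomial entries. *)
Definition compartmental_poly : 'M[mpoly m R]_n :=
  \matrix_(i, j)
    if i == j
    then - vertex_poly i - \sum_(l | (i, l) \in E) edge_poly (i, l)
    else edge_poly (j, i).

Definition diag_compartmental_poly : 'M[mpoly m R]_n :=
  \matrix_(i, j) if i == j then vertex_poly i else edge_poly (j, i).

Lemma compartmental_polyE t :
  @compartmental_mx R n E L t = map_mx (ev t) compartmental_poly.
Proof.
apply/matrixP => v u; rewrite !mxE; case: ifP => _; last by rewrite ev_edge_poly.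
rewrite mevalB mevalN ev_vertex_poly; congr (_ + - _); rewrite raddf_sum.
by apply: eq_bigr => l _; rewrite -ev_edge_poly.
Qed.

Lemma diag_compartmental_polyE t :
  @diag_compartmental_mx R n E L t = map_mx (ev t) diag_compartmental_poly.
Proof.
apply/matrixP => v u; rewrite !mxE; case: ifP => _; last by rewrite ev_edge_poly.
by rewrite ev_vertex_poly.
Qed.

Lemma compartmental_edge t v u :
  @compartmental_mx R n E L t v u != 0 -> v = u \/ (u, v) \in E.
Proof.
rewrite mxE; case: (v =P u) => [|_]; first by left.
by move=> h; right; apply: contra_neqT h => /(edge_param0 t).
Qed.

Lemma diag_compartmental_edge t v u :
  @diag_compartmental_mx R n E L t v u != 0 -> v = u \/ (u, v) \in E.
Proof.
rewrite mxE; case: (v =P u) => [|_]; first by left.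
by move=> h; right; apply: contra_neqT h => /(edge_param0 t).
Qed.

Lemma card_param : m = (#|E| + #|L|)%N.
Proof.
rewrite card_sum !card_sig; congr (_ + _)%N; exact: eq_card.
Qed.

(** The derivative of p in the direction w at the point where all parameters
    are 1.  There, the derivative of a monomial is the sum of the coordinates of
    w over its edges. *)
Definition dir_deriv (w : 'rV[R]_m) (p : mpoly m R) : R :=
  \sum_l w ord0 l * meval (fun=> 1) (mderiv l p).

Lemma dir_deriv_var w l : dir_deriv w (mpvar R l) = w ord0 l.
Proof.
rewrite /dir_deriv (bigD1 l) //= big1 ?addr0 => [|a al].
  rewrite /mpvar mderivX mevalZ mnm1E eqxx mul1r.
  by rewrite -[X in mnm_sub X]add0m addmK mpolyX0 meval1 mulr1.
by rewrite /mpvar mderivX mevalZ mnm1E eq_sym (negbTE al) mul0r mulr0.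
Qed.

Lemma dir_deriv0 w : dir_deriv w 0 = 0.
Proof. by rewrite /dir_deriv big1 // => l _; rewrite mderiv0 meval0 mulr0. Qed.

Lemma dir_deriv_edge w x : dir_deriv w (edge_poly x) = edge_param w x.
Proof.
by rewrite /edge_poly /edge_param; case: insub => [y|]; rewrite ?dir_deriv0 ?dir_deriv_var.
Qed.

Lemma dir_deriv_vertex w v : dir_deriv w (vertex_poly v) = vertex_param w v.
Proof.
by rewrite /vertex_poly /vertex_param; case: insub => [y|];
  rewrite ?dir_deriv0 ?dir_deriv_var.
Qed.

(** The monomial of a list of edges, as a polynomial. *)
Definition monomial_poly (s : seq ('I_n * 'I_n)) : mpoly m R :=
  \prod_(x <- s) edge_poly x.

Lemma ev_monomial_poly (t : pspace R E L) s : ev t (monomial_poly s) = monomial t s.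
Proof.
by rewrite /monomial_poly rmorph_prod; apply: eq_bigr => x _; rewrite /= ev_edge_poly.
Qed.

Lemma dir_deriv_monomial w s : {subset s <= E} ->
  dir_deriv w (monomial_poly s) = \sum_(x <- s) edge_param w x.
Proof.
have one s' : {subset s' <= E} -> meval (fun=> 1) (monomial_poly s') = 1.
  move=> sE; rewrite /monomial_poly rmorph_prod /= big_seq big1 // => x /sE xE.
  by rewrite /edge_poly insubT /mpvar mevalXU.
elim: s => [|x s IH] sE.
  rewrite /monomial_poly !big_nil /dir_deriv big1 // => l _.
  by rewrite -mpolyC1 mderivC meval0 mulr0.
have {}sE : x \in E /\ {subset s <= E}.
  by split => [|y ys]; apply: sE; rewrite inE ?eqxx ?ys ?orbT.
have [xE sE'] := sE.
rewrite big_cons -IH // -dir_deriv_edge /dir_deriv -big_split; apply: eq_bigr => l _ /=.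
rewrite /monomial_poly big_cons mderivM mevalD !mevalM.
rewrite (_ : meval _ (edge_poly x) = 1); last first.
  by rewrite /edge_poly insubT /mpvar mevalXU.
by rewrite -/(monomial_poly s) one //; ring.
Qed.
End Models.

Section PathCycleRank.
Variables (R : realType) (n : nat) (E : {set 'I_n * 'I_n}) (i j : 'I_n).
Local Notation m := #|param E [set: 'I_n]|.

(** A finite index set for the cycles, the paths from i to j, and the
    self-cycles; n bounds the length of the former two. *)
Definition pc_index : finType := (n.-bseq 'I_n + n.-bseq 'I_n + 'I_n)%type.

(** Boolean versions of dicycle and of dipath from i to j. *)
Definition is_cycle (c : seq 'I_n) := [&& c != [::], uniq c & cycle (edge_rel E) c].
Definition is_dipath (p : seq 'I_n) :=
  [&& path (edge_rel E) i p, uniq (i :: p) & last i p == j].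

Lemma is_cycleP c : reflect (dicycle E c) (is_cycle c).
Proof. exact: and3P. Qed.

Lemma is_dipathP p : reflect (dipath E i p j) (is_dipath p).
Proof. by apply: (iffP and3P) => -[? ? H]; split=> //; exact/eqP. Qed.

(** The monomial of a cycle, path or self-cycle.  Indices that stand for none of
    these are sent to the constant 0. *)
Definition pc_poly (x : pc_index) : mpoly m R :=
  match x with
  | inl (inl c) =>
      if is_cycle c then @monomial_poly R n E [set: 'I_n] (cycle_edges c) else 0
  | inl (inr p) =>
      if is_dipath p then @monomial_poly R n E [set: 'I_n] (path_edges i p)
      else 0
  | inr v => @vertex_poly R n E [set: 'I_n] v
  end.

(** The same monomials, indexed by an ordinal. *)
Definition pc_family (b : 'I_#|pc_index|) : mpoly m R := pc_poly (enum_val b).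

(** The coboundaries of the indicator functions of the vertices other than i and
    j, as weightings of the edges; the vertex parameters have weight 0. *)
Definition coboundary : 'M[R]_(#|~: [set i; j]|, m) :=
  \matrix_(a, l) match enum_val l with
    | inl x => (enum_val a == (val x).2)%:R - (enum_val a == (val x).1)%:R
    | inr _ => 0
    end.

Lemma param_ext (w w' : pspace R E [set: 'I_n]) :
  (forall x, x \in E -> edge_param w x = edge_param w' x) ->
  (forall v, vertex_param w v = vertex_param w' v) -> w = w'.
Proof.
move=> He Hv; apply/rowP => l.
rewrite -(enum_valK l); case: (enum_val l) => y.
  have := He (val y) (valP y); rewrite /edge_param.
  by rewrite valK.
have := Hv (val y); rewrite /vertex_param.
by rewrite valK.
Qed.

(** A direction that annihilates all path and cycle monomials is the coboundary
    of a potential vanishing at i and j. *)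
Lemma kernel_coboundary (w : 'rV[R]_m) :
  strongly_io_connected E [set i] [set j] ->
  (forall b, dir_deriv w (pc_family b) = 0) ->
  (w <= coboundary)%MS.
Proof.
move=> sio w0.
have w0' x : dir_deriv w (pc_poly x) = 0.
  by have := w0 (enum_rank x); rewrite /pc_family enum_rankK.
have [c cyc|p hp|h [hi hj hE]] :=
  @potential R n E i j (edge_param w) sio.2 (all_reachable sio).
- have sz : (size c <= n)%N.
    have [_ /card_uniqP <- _] := cyc.
    by rewrite -[X in (_ <= X)%N](card_ord n) max_card.
  have := w0' (inl (inl (Bseq sz))); rewrite /=.
  case: is_cycleP => // _; rewrite dir_deriv_monomial //.
  by have [_ _ /cycle_edges_sub] := cyc.
- have sz : (size p <= n)%N by exact: ltnW (dipath_size hp).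
  have := w0' (inl (inr (Bseq sz))); rewrite /=.
  case: is_dipathP => // _; rewrite dir_deriv_monomial //.
  by have [/path_edges_sub] := hp.
pose hr : 'rV[R]_(#|~: [set i; j]|) := \row_a h (enum_val a).
suff -> : w = hr *m coboundary by exact: submxMl.
have wE v : vertex_param w v = 0.
  by rewrite -dir_deriv_vertex; exact: (w0' (inr v)).
have hsum y : \sum_a hr ord0 a * (enum_val a == y)%:R = h y.
  have [yA|yA] := boolP (y \in ~: [set i; j]).
    rewrite (bigD1 (enum_rank_in yA y)) //= big1 ?addr0.
      by rewrite mxE enum_rankK_in // eqxx mulr1.
    move=> a ya; case: eqP => [E1|]; last by rewrite mulr0.
    by have := enum_valK_in yA a; rewrite E1 => Ea; rewrite -Ea eqxx in ya.
  rewrite big1 => [|a _].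
    by move: yA; rewrite !inE negbK => /orP[] /eqP ->.
  case: eqP => [E1|]; last by rewrite mulr0.
  by have := enum_valP a; rewrite E1 (negbTE yA).
apply: param_ext => [x xE|v].
  rewrite hE // -!hsum -sumrB /edge_param insubT mxE.
  apply: eq_bigr => a _; rewrite -mulrBr; congr (_ * _).
  by rewrite [RHS]mxE enum_rankK.
rewrite wE /vertex_param insubT // => ?; rewrite mxE big1 // => a _.
by rewrite [X in _ * X]mxE enum_rankK mulr0.
Qed.

(** The path and cycle monomials have at least m - (n - 2) independent
    differentials, because their common kernel lies in the span of n - 2
    coboundaries. *)
Lemma path_cycle_rank : i != j -> strongly_io_connected E [set i] [set j] ->
  (m <= n - 2 + \rank (\matrix_(l < m, b < #|pc_index|)
     meval (fun=> 1%R : R) (mderiv l (pc_family b))))%N.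
Proof.
move=> ij sio; set J := \matrix_(l, b) _.
have : (kermx J <= coboundary)%MS.
  apply/row_subP => a; apply: kernel_coboundary => // b.
  have /matrixP/(_ a b) := mulmx_ker J; rewrite mxE [RHS]mxE => H; rewrite -[RHS]H.
  by apply: eq_bigr => l _; rewrite [row _ _ _ _]mxE [J l b]mxE.
move=> /mxrankS; rewrite mxrank_ker => h.
have := leq_trans h (rank_leq_row _); rewrite cardsCs finset.setCK cards2 ij card_ord.
have := rank_leq_row J; lia.
Qed.

End PathCycleRank.

Local Close Scope ring_scope.

Theorem theorem6p4 (R : realType) (n : nat) (E : {set 'I_n * 'I_n})
    (i j : 'I_n) (L : {set 'I_n}) (k : nat) :
  loopless E ->
  i != j ->
  strongly_io_connected E [set i] [set j] ->
  1 <= k ->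
  #|E| + (k + 2) = 2 * n ->
  #|L| = #|[set i] :|: [set j]| ->
  locally_identifiable_model R E [set i] [set j] L \/
    identifiable_path_cycle_model R E [set i] [set j] ->
  exists p : seq 'I_n, dipath E i p j /\ size p <= k.
Proof.
move=> _ ij sio _ cardE cardL ident; apply: contrapT => H.
have nop p : dipath E i p j -> (k < size p)%N.
  by move=> hp; rewrite ltnNge; apply/negP => hk; apply: H; exists p.
have [p0 hp0] := all_reachable sio j.
have kn : (k.+1 < n)%N := leq_ltn_trans (nop _ hp0) (dipath_size hp0).
have {}cardL : #|L| = 2 by rewrite cardL cards2 ij.
case: ident => [ident|[vert cyc pth _]].
  refine (@not_generically_locally_injective R _ (n + (n - k.+1)) _
    (@coef_polys R n _ i j k (compartmental_poly R E L)) _ _ _ ident).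
    move=> t t'; apply: (coef_map_polys _ _ nop).
    - exact: compartmental_polyE.
    - exact: compartmental_edge.
  by rewrite card_param cardL; lia.
have rk := path_cycle_rank R ij sio.
have cm := card_param E [set: 'I_n]; rewrite cardsT card_ord in cm.
have [||b Hb] := @not_locally_identifiable_from R _ (n + (n - k.+1)) _
    (@coef_polys R n _ i j k (diag_compartmental_poly R E [set: 'I_n]))
    (Defs.coef_map [set i] [set j] (@diag_compartmental_mx R n E [set: 'I_n]))
    _ _ (@pc_family R n E i j) (fun=> 1%R).
- move=> t t'; apply: (coef_map_polys _ _ nop).
  + exact: diag_compartmental_polyE.
  + exact: diag_compartmental_edge.
- apply: leq_trans (_ : (#|param E [set: 'I_n]| - (n - 2) <= _)%N); last first.
    by rewrite leq_subLR; exact: rk.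
  by rewrite cm; lia.
(* It remains to see that every member of the family is identifiable. *)
apply: Hb; rewrite /pc_family.
have zero : locally_identifiable_from
    (Defs.coef_map [set i] [set j] (@diag_compartmental_mx R n E [set: 'I_n]))
    (fun=> 0%R).
  have [_ [_ [N0 N0null _]]] := vert i.
  exists (fun=> [set 0%R]%classic); split=> [y|]; first exact: finite_set1.
  by exists N0.
case: (enum_val b) => [[c|p]|v] /=.
- case: is_cycleP => [hc|_]; last first.
    by rewrite (_ : (fun _ => _) = fun=> 0%R) //; apply/funext => t; rewrite meval0.
  rewrite (_ : (fun _ => _) = (fun t => monomial t (cycle_edges c))); first exact: cyc.
  by apply/funext => t; rewrite ev_monomial_poly.
- case: is_dipathP => [hp|_]; last first.
    by rewrite (_ : (fun _ => _) = fun=> 0%R) //; apply/funext => t; rewrite meval0.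
  rewrite (_ : (fun _ => _) = (fun t => monomial t (path_edges i p))).
    by apply: pth hp; rewrite inE.
  by apply/funext => t; rewrite ev_monomial_poly.
- rewrite (_ : (fun _ => _) = (fun t => vertex_param t v)); first exact: vert.
  by apply/funext => t; rewrite ev_vertex_poly.
Qed.
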